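(* Let $T: C^p(X,E) \to C^q(Y,F)$ be a separating, nowhere trivial and continuous linear operator and denote by $h: Y\to X$ its support map. There exist functions $\Phi_k: Y \times \mathcal{S}^k(G,E)\to F$, $k \in \mathbb{N}_p$, so that for all $f \in C^p(X,E)$ and all $y \in Y$, $$Tf(y) = \sum_{k\in\mathbb{N}_p}\Phi_k(y,D^kf(h(y))).$$ For each $y \in Y$, $\Phi_k(y,\cdot): \mathcal{S}^k(G,E) \to F$ is a bounded linear operator and, for each $S \in \mathcal{S}^k(G,E)$, $\Phi_k(\cdot,S): Y\to F$ is continuous on $Y$. Furthermore, for every $y_0 \in Y$, there exist $r > 0$ with $B(y_0,r)\subseteq Y$ and $k_0\in\mathbb{N}_p$ such that $\Phi_k(y,\cdot) = 0$ for all $k\in\mathbb{N}_p$ with $k > k_0$ and all $y \in B(y_0,r)$, and that $\{\Phi_k(y,\cdot): y \in B(y_0,r)\}$ is uniformly bounded (in operator norm) for each $k \leq k_0$.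
   Context: $G,H,E,F$ are real Banach spaces; $X\subseteq G$ and $Y\subseteq H$ are open; $1\le p\le\infty$, $0\le q\le\infty$. $\mathbb{N}_p=\{i\in\mathbb{N}\cup\{0\}: i\le p\}$ (all nonnegative integers if $p=\infty$). $\mathcal{S}^k(G,E)$ is the Banach space of bounded symmetric $k$-linear maps $G^k\to E$, with $\mathcal{S}^0(G,E)=E$. $C^p(X,E)$ is the space of all $f:X\to E$ such that for all $k\in\mathbb{N}_p$ the Fréchet derivative $D^kf$ ($D^0f=f$) is a continuous function from $X$ to $\mathcal{S}^k(G,E)$; $C^p(X)=C^p(X,\mathbb{R})$. $C^p(X,E)$ carries the topology generated by the seminorms $\rho_{K,k}(f)=\sup_{x\in K}\sup_{0\le j\le k}\|D^jf(x)\|$, $K\subseteq X$ compact, $k\in\mathbb{N}_p$; similarly for $C^q(Y,F)$. $B(y,r)$ is the ball with centre $y$ and radius $r$. Standing assumption: there is a bump function $\varphi\in C^p(G)=C^p(G,\mathbb{R})$ with $\varphi(x)=1$ if $\|x\|\le 1/2$, $\varphi(x)=0$ if $\|x\|\ge1$, and $\sup_{x\in G}\|D^k\varphi(x)\|<\infty$ for all $k\in\mathbb{N}_p$. Two functions $f,g$ are disjoint if at every point at least one of them is $0$. A map $T$ is separating if it maps disjoint functions to disjoint functions. $T$ is nowhere trivial if for every $y\in Y$ there is $f\in C^p(X,E)$ with $Tf(y)\ne0$. Support map: let $\mathbb{R}_\infty$ be the one-point compactification of $\mathbb{R}$, $i:X\to\mathbb{R}_\infty^{C^p(X)}$, $i(x)(\psi)=\psi(x)$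 (a homeomorphic embedding), and let $\mathcal{A}X$ be the closure of $i(X)$. For $f\in C^p(X,E)$ let $\overline{C}(f)$ be the closure in $\mathcal{A}X$ of $i(\{x:f(x)\ne0\})$. For $y\in Y$ let $\mathcal{O}_y$ be the family of open subsets $U$ of $\mathcal{A}X$ for which there is $f\in C^p(X,E)$ with $Tf(y)\ne0$ and $\overline{C}(f)\subseteq U$. Then $h(y)$ is the unique point of $\bigcap\{\overline{U}^{\mathcal{A}X}:U\in\mathcal{O}_y\}$; for $T$ continuous, separating and nowhere trivial, $h(y)\in i(X)$, and $i(X)$ is identified with $X$, so that $h:Y\to X$ (a continuous map). *)

(* Defs.v *)
From HB Require Import structures.
From mathcomp Require Import all_boot all_order all_algebra all_fingroup.
From mathcomp Require Import all_classical all_reals all_analysis.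

Set Implicit Arguments.
Unset Strict Implicit.
Unset Printing Implicit Defensive.
Import Order.TTheory GRing.Theory Num.Theory.
Import numFieldNormedType.Exports.
Local Open Scope classical_set_scope.
Local Open Scope ring_scope.

Section BoundedSymmetricMultilinear.
Variables (R : realType) (G E : normedModType R) (k : nat).
Implicit Types (S : ('I_k -> G) -> E) (v : 'I_k -> G).

Definition replace_arg v i u : 'I_k -> G := fun j => if j == i then u else v j.

Definition multilinear S := forall i v, linear (fun u => S (replace_arg v i u)).

Definition symmetric_map S := forall (s : 'S_k) v, S (v \o s) = S v.

Definition bounded_multi S :=
  exists M : R, forall v, `|S v| <= M * \prod_(i < k) `|v i|.

Definition sym_pred : {pred ('I_k -> G) -> E} :=
  fun S => `[< [/\ multilinear S, symmetric_map S & bounded_multi S] >].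

Lemma sym_pred_submod : submod_closed sym_pred.
Proof.
split=> [|a S1 S2 /asboolP[l1 s1 [M1 b1]] /asboolP[l2 s2 [M2 b2]]].
  apply/asboolP; split=> [i v a x y|//|]; first by rewrite scaler0 addr0.
  by exists 0 => v; rewrite mul0r normr0.
apply/asboolP; split=> [i v c x y|s v|].
- rewrite !fctE (l1 i v c x y) (l2 i v c x y) !scalerDr !scalerA.
  by rewrite (mulrC a) addrACA.
- by rewrite !fctE s1 s2.
- exists (`|a| * M1 + M2) => v; rewrite !fctE mulrDl (le_trans (ler_normD _ _))//.
  by rewrite lerD// normrZ -mulrA ler_wpM2l.
Qed.

HB.instance Definition _ :=
  GRing.isSubmodClosed.Build R (('I_k -> G) -> E) sym_pred sym_pred_submod.

(* S^k(G, E); for k = 0 the domain 'I_0 -> G is a singleton and the elements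
   are the constants, see sym0 below. *)
Record SymL := MkSymL { SymL_fun :> ('I_k -> G) -> E ; _ : SymL_fun \in sym_pred }.

HB.instance Definition _ := [isSub for SymL_fun].
HB.instance Definition _ := [Choice of SymL by <:].
HB.instance Definition _ := [SubChoice_isSubLmodule of SymL by <:].

Definition sym_norm (S : SymL) : R :=
  sup [set `|S v| | v in [set v : 'I_k -> G | forall i, `|v i| <= 1]].

Lemma SymP (S : SymL) :
  [/\ multilinear S, symmetric_map S & bounded_multi S].
Proof. by case: S => S /= /asboolP. Qed.

Lemma SymD (S1 S2 : SymL) v : (S1 + S2) v = S1 v + S2 v. Proof. by []. Qed.

Lemma SymZ a (S : SymL) v : (a *: S) v = a *: S v. Proof. by []. Qed.

Lemma multilinearZ S (c : 'I_k -> R) v : multilinear S ->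
  S (fun i => c i *: v i) = (\prod_(i < k) c i) *: S v.
Proof.
move=> lS; have scal i w a : S (replace_arg w i (a *: w i)) = a *: S w.
  have l0 : S (replace_arg w i 0) = 0.
    by have := lS i w (-1) 0 0; rewrite scaleN1r oppr0 addr0 scaleN1r addNr.
  have := lS i w a (w i) 0; rewrite addr0 l0 addr0 => ->; congr (_ *: S _).
  by apply/funext => j; rewrite /replace_arg; case: eqP => [->|].
suff H s : uniq s -> S (fun i => if i \in s then c i *: v i else v i) =
    (\prod_(i <- s) c i) *: S v.
  have := H (index_enum 'I_k) (index_enum_uniq _).
  by under eq_fun do rewrite mem_index_enum.
elim: s => [_|i s IH /= /andP[nis us]].
  by rewrite big_nil scale1r; congr S.
rewrite big_cons -scalerA -IH// -(scal i); congr S.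
apply/funext => j; rewrite /replace_arg inE.
by case: eqP => [->|//]; rewrite (negbTE nis).
Qed.

Lemma sym_norm_has_sup (S : SymL) :
  has_sup [set `|S v| | v in [set v : 'I_k -> G | forall i, `|v i| <= 1]].
Proof.
split; first by exists `|S 0|, 0 => // i; rewrite normr0.
have [_ _ [M b]] := SymP S.
exists `|M| => _ [v v1 <-]; rewrite (le_trans (b v))//.
rewrite (le_trans (ler_norm _))// normrM ler_piMr// ger0_norm ?prodr_ge0//.
by rewrite prodr_ile1// => i _; rewrite normr_ge0 v1.
Qed.

Lemma sym_norm_ge0 (S : SymL) : 0 <= sym_norm S.
Proof.
rewrite (le_trans (normr_ge0 (S 0)))//; apply: ub_le_sup.
  by have [] := sym_norm_has_sup S.
by exists 0 => // i; rewrite normr0.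
Qed.

Lemma sym_norm_le (S : SymL) v : `|S v| <= sym_norm S * \prod_(i < k) `|v i|.
Proof.
have [lS _ _] := SymP S.
have vE : v = (fun i => `|v i| *: (`|v i|^-1 *: v i)).
  apply/funext => i; have [->|v0] := eqVneq (v i) 0; first by rewrite !scaler0.
  by rewrite scalerA mulfV ?scale1r// normr_eq0.
rewrite {1}vE (multilinearZ (fun i => `|v i|) _ lS) normrZ.
rewrite ger0_norm ?prodr_ge0// mulrC ler_wpM2r ?prodr_ge0//.
apply: ub_le_sup; first by have [] := sym_norm_has_sup S.
exists (fun i => `|v i|^-1 *: v i) => // i.
rewrite normrZ normfV normr_id.
have [->|v0] := eqVneq (v i) 0; first by rewrite normr0 mulr0.
by rewrite mulVf// normr_eq0.
Qed.

Lemma sym_normD (S1 S2 : SymL) :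
  sym_norm (S1 + S2) <= sym_norm S1 + sym_norm S2.
Proof.
apply: ge_sup; first by have [] := sym_norm_has_sup (S1 + S2).
move=> _ [v v1 <-]; rewrite SymD (le_trans (ler_normD _ _))// lerD//.
  by apply: ub_le_sup; [have [] := sym_norm_has_sup S1|exists v].
by apply: ub_le_sup; [have [] := sym_norm_has_sup S2|exists v].
Qed.

Lemma sym_normZ_le a (S : SymL) : sym_norm (a *: S) <= `|a| * sym_norm S.
Proof.
apply: ge_sup; first by have [] := sym_norm_has_sup (a *: S).
move=> _ [v v1 <-]; rewrite SymZ normrZ ler_wpM2l//.
by apply: ub_le_sup; [have [] := sym_norm_has_sup S|exists v].
Qed.

Lemma sym_normZ a (S : SymL) : sym_norm (a *: S) = `|a| * sym_norm S.
Proof.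
apply/eqP; rewrite eq_le sym_normZ_le/=.
have [->|a0] := eqVneq a 0.
  by rewrite normr0 mul0r sym_norm_ge0.
have := sym_normZ_le a^-1 (a *: S).
rewrite scalerA mulVf// scale1r normfV -(ler_pM2l (_ : 0 < `|a|)) ?normr_gt0//.
by rewrite mulrA mulfV ?normr_eq0// mul1r.
Qed.

Lemma sym_norm0_eq0 (S : SymL) : sym_norm S = 0 -> S = 0.
Proof.
move=> S0; apply/val_inj/funext => v; apply/eqP; rewrite -normr_le0.
by have := sym_norm_le S v; rewrite S0 mul0r.
Qed.

HB.instance Definition _ :=
  Lmodule_isNormed.Build R SymL sym_normD sym_normZ sym_norm0_eq0.

End BoundedSymmetricMultilinear.

Section Smooth.
Variables (R : realType) (G E : normedModType R).

Lemma sym0_subproof (a : E) : (fun=> a) \in @sym_pred R G E 0.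
Proof.
apply/asboolP; split=> [[]//|//|].
by exists `|a| => v; rewrite big_ord0 mulr1.
Qed.

(* the identification of E with S^0(G, E) *)
Definition sym0 (a : E) : SymL G E 0 := MkSymL (sym0_subproof a).

Definition uncurry_sym k (L : G -> SymL G E k) (v : 'I_k.+1 -> G) : E :=
  L (v ord0) (fun i => v (lift ord0 i)).

(* D^k f. The default value 0 of insubd is never used on the domain of a C^p
   function: is_Cp requires the Frechet derivative of D^k f to exist there and,
   read as a (k+1)-linear map, to belong to S^(k+1)(G, E). *)
Fixpoint Deriv k (f : G -> E) : G -> SymL G E k :=
  match k with
  | 0 => fun x => sym0 (f x)
  | k'.+1 => fun x => insubd 0 (uncurry_sym ('d (Deriv k' f) x))
  end.

(* p : option nat stands for an element of {0, 1, 2, ...} u {oo}, with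
   None = oo, and in_Np p is the set N_p. *)
Definition in_Np (p : option nat) (k : nat) : bool :=
  if p is Some n then (k <= n)%N else true.

Arguments Deriv : simpl never.

Definition is_Cp (X : set G) (p : option nat) (f : G -> E) : Prop :=
  [/\ forall x, ~ X x -> f x = 0,
      forall k, in_Np p k.+1 -> forall x, X x ->
        differentiable (Deriv k f) x /\
        uncurry_sym ('d (Deriv k f) x) \in @sym_pred R G E k.+1 &
      forall k, in_Np p k -> {within X, continuous (Deriv k f)}].

Lemma DerivS k f x : uncurry_sym ('d (Deriv k f) x) \in @sym_pred R G E k.+1 ->
  Deriv k.+1 f x = uncurry_sym ('d (Deriv k f) x) :> (('I_k.+1 -> G) -> E).
Proof. by move=> ?; exact: insubdK. Qed.

Lemma Sym_linear_ext k (A B C : SymL G E k) (fA fB fC : ('I_k -> G) -> E) a :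
  A = fA :> (_ -> _) -> B = fB :> (_ -> _) -> C = fC :> (_ -> _) ->
  fC = a *: fA + fB -> C = a *: A + B.
Proof. by move=> <- <- <- CE; apply: val_inj. Qed.

Lemma in_NpS p k : in_Np p k.+1 -> in_Np p k.
Proof. by case: p => [n|//] /=; exact: ltnW. Qed.

Lemma near_eq_diff (V W : normedModType R) (f g : V -> W) (x : V) :
  {near x, f =1 g} -> differentiable f x ->
  differentiable g x /\ 'd g x = 'd f x :> (V -> W).
Proof.
move=> fg df; have [cdf dfE] := (diff_locallyxP _ _).1 df.
have gxE : g \o shift x = cst (g x) + 'd f x +o_0 id.
  apply/eqaddoP => _/posnumP[e].
  have fx : f x = g x by exact: nbhs_singleton fg.
  have /eqaddoP/(_ _ (gt0 e)) fe :
      f \o shift x = cst (f x) + 'd f x +o_0 id.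
    by apply/funext => h; rewrite !fctE dfE.
  near=> h.
  have -> : (g \o shift x - (cst (g x) + 'd f x)) h =
            (f \o shift x - (cst (f x) + 'd f x)) h.
    rewrite !fctE fx; congr (_ - _) => /=; apply/esym.
    by near: h; move: fg; rewrite (near_shift 0) subr0.
  by near: h.
have dE : 'd g x = 'd f x :> (V -> W) by exact: diff_unique.
split; last exact: dE.
apply/diff_locallyxP; split=> [|h]; first by rewrite dE.
by rewrite dE -[LHS]/((g \o shift x) h) [in LHS]gxE.
Unshelve. all: by end_near. Qed.

Lemma near_eq_diff_linear (V W : normedModType R) (f g h : V -> W) a (x : V) :
  {near x, a *: f + g =1 h} -> differentiable f x -> differentiable g x ->
  differentiable h x /\ forall u, 'd h x u = a *: 'd f x u + 'd g x u.
Proof.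
move=> nE df dg; have daf := differentiableZ a df.
have [dh hE] := near_eq_diff nE (differentiableD daf dg); split; first exact: dh.
by move=> u; rewrite hE (diffD daf dg) (diffZ _ df).
Qed.

Lemma Deriv_linear (X : set G) p a f g : open X -> is_Cp X p f -> is_Cp X p g ->
  forall k, in_Np p k -> forall x, X x ->
    Deriv k (a *: f + g) x = a *: Deriv k f x + Deriv k g x /\
    (in_Np p k.+1 -> differentiable (Deriv k (a *: f + g)) x /\
      uncurry_sym ('d (Deriv k (a *: f + g)) x) =
      a *: uncurry_sym ('d (Deriv k f) x) + uncurry_sym ('d (Deriv k g) x)).
Proof.
move=> oX [_ df _] [_ dg _].
have step k x : X x -> in_Np p k.+1 ->
    (forall y, X y -> Deriv k (a *: f + g) y = a *: Deriv k f y + Deriv k g y) ->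
    differentiable (Deriv k (a *: f + g)) x /\
      uncurry_sym ('d (Deriv k (a *: f + g)) x) =
      a *: uncurry_sym ('d (Deriv k f) x) + uncurry_sym ('d (Deriv k g) x).
  move=> Xx pk kE.
  have [dfx _] := df k pk x Xx; have [dgx _] := dg k pk x Xx.
  have nE : {near x, a *: Deriv k f + Deriv k g =1 Deriv k (a *: f + g)}.
    have : nbhs x X by exact: open_nbhs_nbhs.
    by apply: filterS => y Xy; rewrite kE.
  have [dh hE] := near_eq_diff_linear nE dfx dgx; split; first exact: dh.
  by apply/funext => v; rewrite [LHS]/uncurry_sym hE.
elim=> [|k IH] pk x Xx.
  have D0 y : Deriv 0 (a *: f + g) y = a *: Deriv 0 f y + Deriv 0 g y.
    by apply/val_inj/funext.
  by split=> [|p1]; [exact: D0|exact: step].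
have DS y : X y ->
    Deriv k.+1 (a *: f + g) y = a *: Deriv k.+1 f y + Deriv k.+1 g y.
  move=> Xy; have [_ /(_ pk) [_ uE]] := IH (in_NpS pk) y Xy.
  have [_ uf] := df k pk y Xy; have [_ ug] := dg k pk y Xy.
  have uS : uncurry_sym ('d (Deriv k (a *: f + g)) y) \in @sym_pred R G E k.+1.
    by rewrite uE; exact: (proj2 (@sym_pred_submod R G E k.+1) a _ _ uf ug).
  exact: (Sym_linear_ext (DerivS uf) (DerivS ug) (DerivS uS) uE).
by split=> [|pk2]; [exact: DS|exact: step].
Qed.

Lemma Deriv_cst0 k : Deriv k (0 : G -> E) = fun=> 0.
Proof.
elim: k => [|k IH]; apply/funext => x; first exact/val_inj.
have u0 : uncurry_sym ('d (Deriv k (0 : G -> E)) x) = 0.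
  by apply/funext => v; rewrite /uncurry_sym IH diff_cst.
have s0 : uncurry_sym ('d (Deriv k (0 : G -> E)) x) \in @sym_pred R G E k.+1.
  by rewrite u0; exact: rpred0.
by apply: val_inj; rewrite [LHS](DerivS s0) u0.
Qed.

Definition Cp_pred (X : set G) of open X := fun p : option nat =>
  [pred f : G -> E | `[< is_Cp X p f >]] : {pred G -> E}.

Lemma Cp_submod (X : set G) (oX : open X) p : submod_closed (Cp_pred oX p).
Proof.
split=> [|a f g /asboolP Cf /asboolP Cg]; apply/asboolP; split.
- by [].
- move=> k pk x Xx; rewrite Deriv_cst0; split; first exact: differentiable_cst.
  rewrite (_ : uncurry_sym _ = 0); first exact: rpred0.
  by apply/funext => v; rewrite /uncurry_sym diff_cst.
- by move=> k _; rewrite Deriv_cst0; apply: continuous_subspaceT => x; exact: cvg_cst.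
- move=> x nXx; have [f0 _ _] := Cf; have [g0 _ _] := Cg.
  by rewrite !fctE f0// g0// scaler0 addr0.
- move=> k pk x Xx.
  have [_ /(_ pk) [dh ->]] := Deriv_linear a oX Cf Cg (in_NpS pk) Xx.
  split; first exact: dh.
  have [_] := @sym_pred_submod R G E k.+1; apply.
    by have [_ /(_ _ pk _ Xx) []] := Cf.
  by have [_ /(_ _ pk _ Xx) []] := Cg.
- move=> k pk.
  have [_ _ /(_ _ pk) cf] := Cf; have [_ _ /(_ _ pk) cg] := Cg.
  apply: (@subspace_eq_continuous _ X _ (a *: Deriv k f + Deriv k g)).
    by move=> x /set_mem Xx; have [e _] := Deriv_linear a oX Cf Cg pk Xx; exact: esym e.
  by apply: within_continuousD cg => x; apply: cvgZr; exact: cf.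
Qed.

End Smooth.

Section SpaceCp.
Variables (R : realType) (G : normedModType R) (X : set G) (oX : open X).
Variables (p : option nat) (E : normedModType R).

HB.instance Definition _ :=
  GRing.isSubmodClosed.Build R (G -> E) (@Cp_pred R G E X oX p) (@Cp_submod R G E X oX p).

(* A function X -> E is encoded by its extension by 0 to G, see is_Cp. *)
Record Cp := MkCp { Cp_fun :> G -> E ; _ : Cp_fun \in @Cp_pred R G E X oX p }.

HB.instance Definition _ := [isSub for Cp_fun].
HB.instance Definition _ := [Choice of Cp by <:].
HB.instance Definition _ := [SubChoice_isSubLmodule of Cp by <:].
HB.instance Definition _ := isPointed.Build Cp 0.

Definition rho (K : set G) (k : nat) (f : Cp) : R :=
  sup [set \big[Num.max/0]_(j < k.+1) `|Deriv j f x| | x in K].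

Definition rho_index : set (Cp * (set G * nat * R)) :=
  [set i | let: (_, (K, k, e)) := i in
    [/\ compact K, K `<=` X, in_Np p k & 0 < e]].

Definition rho_ball (i : Cp * (set G * nat * R)) : set Cp :=
  let: (f, (K, k, e)) := i in [set g | rho K k (g - f) < e].

HB.instance Definition _ := isSubBaseTopological.Build Cp rho_index rho_ball.

End SpaceCp.

Section SupportMap.
Variables (R : realType) (G H E F : normedModType R).
Variables (X : set G) (oX : open X) (p : option nat).
Variables (Y : set H) (oY : open Y) (q : option nat).

Definition disjoint_on (V W : normedModType R) (Z : set V) (f g : V -> W) :=
  forall z, Z z -> f z = 0 \/ g z = 0.

Definition separating (T : Cp oX p E -> Cp oY q F) :=
  forall f g : Cp oX p E, disjoint_on X f g -> disjoint_on Y (T f) (T g).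

Definition nowhere_trivial (T : Cp oX p E -> Cp oY q F) :=
  forall y, Y y -> exists f, T f y <> 0.

Definition embedX (x : G) : {ptws Cp oX p R -> one_point_compactification R} :=
  fun psi => Some (psi x).

(* the set underlying AX; AX itself is its coercion to a type, which carries
   the subspace topology *)
Definition AX : set {ptws Cp oX p R -> one_point_compactification R} :=
  closure (embedX @` X).

Definition Cbar (f : Cp oX p E) : set AX :=
  closure [set z : AX | exists x, [/\ X x, f x <> 0 & \val z = embedX x]].

Definition Oy (T : Cp oX p E -> Cp oY q F) (y : H) : set (set AX) :=
  [set U | open U /\ exists f, T f y <> 0 /\ Cbar f `<=` U].

(* the point h(y) in X with i(h(y)) the unique element of the intersection *)
Definition support_map (T : Cp oX p E -> Cp oY q F) (y : H) : G :=
  get [set x | X x /\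
    \bigcap_(U in Oy T y) closure U = [set z : AX | \val z = embedX x]].

End SupportMap.

(* Main.v *)
Require Import Defs.
From HB Require Import structures.
From mathcomp Require Import all_boot all_order all_algebra all_fingroup.
From mathcomp Require Import all_classical all_reals all_analysis.
From mathcomp Require Import ring lra.

Set Implicit Arguments.
Unset Strict Implicit.
Unset Printing Implicit Defensive.
Import Order.TTheory GRing.Theory Num.Theory.
Import numFieldNormedType.Exports.
Local Open Scope classical_set_scope.
Local Open Scope ring_scope.

(** The operator [T] is local: the value [T f y] only depends on [f] near the
    point [h y], where [h] is the support map.  Indeed, by continuity the
    functional [f |-> T f y] is controlled by the derivatives of [f] on a compact
    set [K], and cutting functions into small pieces with bump functions locates
    a point of [K] around which functions with nonzero image at [y] live
    ([support_at_exists]); since [T] is separating, functions vanishing near that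
    point are sent to functions vanishing at [y] ([support_at_near]).  This
    point is the support point defined through the compactification
    ([support_at_Oy], [support_mapP]), and it depends continuously on [y]
    ([support_map_near]).

    The value [T f y] even depends only on finitely many derivatives of [f] at
    [h y].  If those of order at most [k] vanish there, [k] being the order of the
    seminorm controlling [T], then multiplying [f] by bumps of radius tending
    to 0, which does not change [T f y], makes it tend to 0 in that seminorm: the
    Taylor estimate for [f] compensates the growth of the derivatives of the
    bumps ([flat_eq0]).  Hence [T f y] is the image at [y] of the Taylor
    polynomial of [f] at [h y], and [Phi] is the image of a homogeneous
    polynomial ([T_taylor]).

    The local statements follow by applying the estimates on a sequence
    converging to [y0] together with its limit ([locally_uniform]).

    Derivatives of all orders are handled through jets, functions on lists of
    directions.  A function is C^p exactly when it has a jet ([has_jet_Cp],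
    [Cp_has_jet]), and its derivatives are then read off the jet
    ([has_jet_Deriv]).  For products the jet is given by the Leibniz recursion
    [leib], for polynomials by [pjet]. *)

(** * Jets: symmetric multilinear maps of all orders at once *)

Section Jet.
Variables (R : realType) (G : normedModType R).

Definition nprod (w : seq G) : R := \prod_(v <- w) `|v|.

Lemma nprod_nil : nprod [::] = 1. Proof. exact: big_nil. Qed.
Lemma nprod_cons v w : nprod (v :: w) = `|v| * nprod w.
Proof. exact: big_cons. Qed.
Lemma nprod_cat u w : nprod (u ++ w) = nprod u * nprod w.
Proof. exact: big_cat. Qed.
Lemma nprod_nseq n v : nprod (nseq n v) = `|v| ^+ n.
Proof. by elim: n => [|n IH] /=; rewrite ?nprod_nil// nprod_cons IH exprS. Qed.
Lemma nprod_ge0 w : 0 <= nprod w.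
Proof. by apply: prodr_ge0. Qed.
Variable E : normedModType R.
Implicit Types (A B : seq G -> E).

Definition jet_le (n : nat) (M : R) A :=
  forall w, (size w <= n)%N -> `|A w| <= M * nprod w.

(** Symmetric multilinear maps of all orders form one function on lists of
    directions: prepending a direction then corresponds to differentiating, and
    no casts between orders arise.  Linearity is asked in the head position
    only, since invariance under permutations carries it to the others. *)
Definition symjet A :=
  [/\ forall u w, perm_eq u w -> A u = A w,
      forall w, linear (fun v => A (v :: w)) &
      forall n, exists2 M, 0 <= M & jet_le n M A].

Lemma symjet_perm A u w : symjet A -> perm_eq u w -> A u = A w.
Proof. by case=> + _ _; apply. Qed.

Lemma symjet_swap A u v w : symjet A -> A (u :: v :: w) = A (v :: u :: w).
Proof. by move=> sA; apply: (symjet_perm sA); rewrite (perm_catCA [:: u] [:: v]). Qed.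

Lemma symjet_lin A a u v w : symjet A ->
  A (a *: u + v :: w) = a *: A (u :: w) + A (v :: w).
Proof. by case=> _ lA _; exact: lA. Qed.

Lemma symjetD A u v w : symjet A -> A (u + v :: w) = A (u :: w) + A (v :: w).
Proof. by move=> sA; rewrite -[u]scale1r symjet_lin// !scale1r. Qed.

Lemma symjet_head0 A w : symjet A -> A (0 :: w) = 0.
Proof.
move=> sA; have := symjet_lin (-1) 0 0 w sA.
by rewrite scaler0 addr0 scaleN1r addNr.
Qed.

Lemma symjetZ A a u w : symjet A -> A (a *: u :: w) = a *: A (u :: w).
Proof.
by move=> sA; rewrite -[a *: u]addr0 symjet_lin// symjet_head0// addr0.
Qed.

Lemma symjet_cons A v : symjet A -> symjet (fun w => A (v :: w)).
Proof.
move=> sA; split=> [u w uw|w a x y|n].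
- by apply: (symjet_perm sA); rewrite perm_cons.
- by rewrite !(symjet_swap v)// symjet_lin.
- have [_ _ /(_ n.+1)[M M0 bM]] := sA; exists (M * `|v|); first exact: mulr_ge0.
  by move=> w wn; rewrite -mulrA -nprod_cons bM.
Qed.

Lemma symjet_cat A u : symjet A -> symjet (fun w => A (u ++ w)).
Proof.
by elim: u A => [|v u IH] A sA //=; apply: (IH (fun w => A (v :: w))); exact: symjet_cons.
Qed.

Lemma jet_le_cons n M A v : jet_le n.+1 M A ->
  jet_le n (M * `|v|) (fun w => A (v :: w)).
Proof. by move=> bM w wn; rewrite -mulrA -nprod_cons bM. Qed.

Lemma jet_leW n m M N A : (m <= n)%N -> M <= N -> jet_le n M A -> jet_le m N A.
Proof.
move=> mn MN bA w wm; rewrite (le_trans (bA w (leq_trans wm mn)))//.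
by rewrite ler_wpM2r// nprod_ge0.
Qed.

End Jet.

Section Leibniz.
Variables (R : realType) (G E : normedModType R).
Implicit Types (A : seq G -> R) (B : seq G -> E).

(** The Leibniz rule as a recursion: differentiating a product in the
    direction [v] hits one of the two factors.  Unfolding it yields the sum
    over all ways to distribute the directions among the factors. *)
Fixpoint leib A B (w : seq G) : E :=
  if w is v :: w' then leib (fun u => A (v :: u)) B w' +
                       leib A (fun u => B (v :: u)) w'
  else A [::] *: B [::].

Lemma leib_linl a A A1 A2 B w : (forall u, A u = a * A1 u + A2 u) ->
  leib A B w = a *: leib A1 B w + leib A2 B w.
Proof.
elim: w A A1 A2 B => [|v w IH] A A1 A2 B AE /=.
  by rewrite AE scalerDl scalerA.
rewrite (IH (fun u => A (v :: u)) (fun u => A1 (v :: u)) (fun u => A2 (v :: u)))//.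
by rewrite (IH A A1 A2)// scalerDr addrACA.
Qed.

Lemma leib_linr a A B B1 B2 w : (forall u, B u = a *: B1 u + B2 u) ->
  leib A B w = a *: leib A B1 w + leib A B2 w.
Proof.
elim: w A B B1 B2 => [|v w IH] A B B1 B2 BE /=.
  by rewrite BE scalerDr !scalerA mulrC.
rewrite (IH A (fun u => B (v :: u)) (fun u => B1 (v :: u)) (fun u => B2 (v :: u)))//.
by rewrite (IH _ B B1 B2)// scalerDr addrACA.
Qed.

Lemma leibBl A1 A2 B w :
  leib (fun u => A1 u - A2 u) B w = leib A1 B w - leib A2 B w.
Proof.
rewrite (@leib_linl (-1) _ A2 A1) ?scaleN1r 1?addrC// => u.
by rewrite mulN1r addrC.
Qed.

Lemma leibBr A B1 B2 w :
  leib A (fun u => B1 u - B2 u) w = leib A B1 w - leib A B2 w.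
Proof.
rewrite (@leib_linr (-1) _ _ B2 B1) ?scaleN1r 1?addrC// => u.
by rewrite scaleN1r addrC.
Qed.

(** The geometric weights [s ^ k] match the way a bump function supported in
    a ball of radius [1 / s] gains one factor [s] per derivative. *)
Lemma leib_le_scaled n s a b A B : 0 <= s -> 0 <= a -> 0 <= b ->
  (forall w, (size w <= n)%N -> `|A w| <= a * s ^+ size w * nprod w) ->
  (forall w, (size w <= n)%N -> `|B w| <= b * s ^+ size w * nprod w) ->
  forall w, (size w <= n)%N ->
    `|leib A B w| <= a * b * (2 * s) ^+ size w * nprod w.
Proof.
move=> s0; elim: n a b A B => [|n IH] a b A B a0 b0 bA bB [|v w]//= wn.
- have := bA [::] (leqnn _); have := bB [::] (leqnn _).
  rewrite !expr0 !nprod_nil !mulr1 normrZ => bb aa; exact: ler_pM.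
- have := bA [::] (leq0n _); have := bB [::] (leq0n _).
  rewrite !expr0 !nprod_nil !mulr1 normrZ => bb aa; exact: ler_pM.
- rewrite ltnS in wn; rewrite (le_trans (ler_normD _ _))//.
  have -> : a * b * (2 * s) ^+ (size w).+1 * nprod (v :: w) =
    (a * s * `|v|) * b * (2 * s) ^+ size w * nprod w +
    a * (b * s * `|v|) * (2 * s) ^+ size w * nprod w.
    by rewrite exprS nprod_cons; ring.
  apply: lerD; apply: IH => //.
  + by rewrite !mulr_ge0.
  + move=> u un; rewrite (le_trans (bA _ _))//= exprS nprod_cons.
    by rewrite [leRHS](_ : _ = a * (s * s ^+ size u) * (`|v| * nprod u))//; ring.
  + by move=> u un; apply: bB; rewrite ltnW.
  + by rewrite !mulr_ge0.
  + by move=> u un; apply: bA; rewrite ltnW.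
  + move=> u un; rewrite (le_trans (bB _ _))//= exprS nprod_cons.
    by rewrite [leRHS](_ : _ = b * (s * s ^+ size u) * (`|v| * nprod u))//; ring.
Qed.

Lemma leib_le n a b A B : 0 <= a -> 0 <= b ->
  jet_le n a A -> jet_le n b B -> jet_le n (2 ^+ n * (a * b)) (leib A B).
Proof.
move=> a0 b0 bA bB w wn.
have := @leib_le_scaled n 1 a b A B ler01 a0 b0.
rewrite mulr1 => /(_ _ _ _ wn) H; rewrite (le_trans (H _ _))//.
- by move=> u un; rewrite expr1n mulr1 bA.
- by move=> u un; rewrite expr1n mulr1 bB.
- rewrite ler_wpM2r ?nprod_ge0// mulrC ler_wpM2r ?mulr_ge0//.
  by rewrite ler_weXn2l// ler1n.
Qed.

Lemma leib_swap A B u v w : symjet A -> symjet B ->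
  leib A B (u :: v :: w) = leib A B (v :: u :: w).
Proof.
move=> sA sB /=; rewrite addrACA; congr (_ + _ + (_ + _)).
- by congr leib; apply/funext => z; rewrite symjet_swap.
- by congr leib; apply/funext => z; rewrite symjet_swap.
Qed.

Lemma leib_front A B u v w : symjet A -> symjet B ->
  leib A B (u ++ v :: w) = leib A B (v :: u ++ w).
Proof.
elim: u A B => [//|x u IH] A B sA sB; rewrite cat_cons -[RHS]leib_swap//.
rewrite [LHS]/= IH ?IH//; exact: symjet_cons.
Qed.

(** Permutations are generated by moving one entry to the front
    ([leib_front]), so the symmetry of [leib A B] follows from that of the
    factors although its recursion treats the first direction specially. *)
Lemma leib_symjet A B : symjet A -> symjet B -> symjet (leib A B).
Proof.
move=> sA sB; split=> [u w uw|w a x y|n].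
- elim: u A B w sA sB uw => [|v u IH] A B w sA sB uw.
    by rewrite perm_sym in uw; move/perm_nilP: uw => ->.
  have vw : v \in w by rewrite -(perm_mem uw) mem_head.
  case/splitPr: {w} vw uw => w1 w2 uw.
  rewrite leib_front//=.
  have uw' : perm_eq u (w1 ++ w2).
    by rewrite -(perm_cons v) (perm_trans uw)// (perm_catCA w1 [:: v]).
  by rewrite (IH _ _ _ _ _ uw') ?(IH _ _ _ _ _ uw')//; exact: symjet_cons.
- rewrite /= (@leib_linl a (fun u => A (a *: x + y :: u)) (fun u => A (x :: u)) (fun u => A (y :: u))); last first.
    by move=> u; exact: (symjet_lin a x y u sA).
  rewrite (@leib_linr a A (fun u => B (a *: x + y :: u)) (fun u => B (x :: u)) (fun u => B (y :: u))); last first.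
    by move=> u; exact: (symjet_lin a x y u sB).
  by rewrite scalerDr addrACA.
- have [_ _ /(_ n)[a a0 bA]] := sA; have [_ _ /(_ n)[b b0 bB]] := sB.
  exists (2 ^+ n * (a * b)); first by rewrite !mulr_ge0.
  exact: leib_le.
Qed.

End Leibniz.

(** * Functions of class C^p in terms of jets *)

Section Frechet.
Variables (R : realType) (V W : normedModType R).

(** The Frechet derivative is recognised by a bounded linear candidate and a
    norm estimate, without Landau symbols. *)
Lemma frechet_differentiable (f df : V -> W) (M : R) x :
  linear df -> (forall h, `|df h| <= M * `|h|) ->
  (forall e, 0 < e ->
    \forall h \near (0 : V), `|f (x + h) - f x - df h| <= e * `|h|) ->
  differentiable f x /\ 'd f x = df :> (V -> W).
Proof.
move=> ldf bdf fE.
pose L : {linear V -> W} := HB.pack df (GRing.isLinear.Build _ _ _ _ _ ldf).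
have cL : continuous L.
  apply: bounded_linear_continuous; apply/linear_boundedP.
  exists M; split; first exact: num_real.
  by move=> r Mr h; rewrite (le_trans (bdf h))// ler_wpM2r// ltW.
have lo : f \o shift x = cst (f x) + L +o_0 id.
  apply/eqaddoP => _/posnumP[e]; near=> h.
  rewrite !fctE /= (addrC h) opprD addrA; near: h.
  exact: (fE e%:num (gt0 e)).
have dE : 'd f x = L :> (V -> W) by exact: diff_unique.
split; last exact: dE.
apply/diff_locallyxP; split=> [|h]; first by rewrite dE.
by rewrite dE -[LHS]/((f \o shift x) h) [in LHS]lo.
Unshelve. all: by end_near. Qed.

Lemma differentiable_near (f : V -> W) x e : differentiable f x -> 0 < e ->
  \forall h \near (0 : V), `|f (x + h) - f x - 'd f x h| <= e * `|h|.
Proof.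
move=> /diff_locallyP[_ /eqaddoP fo] e0; have := fo _ e0.
by apply: filterS => h; rewrite !fctE /= (addrC h) opprD addrA.
Qed.

End Frechet.

Section SymJet.
Variables (R : realType) (G E : normedModType R).
Implicit Types (A : seq G -> E) (k : nat).

Definition jet_fun A k (v : 'I_k -> G) : E := A [seq v i | i <- enum 'I_k].

Lemma nprod_enum k (v : 'I_k -> G) :
  nprod [seq v i | i <- enum 'I_k] = \prod_(i < k) `|v i|.
Proof. by rewrite /nprod big_map big_enum. Qed.

Lemma jet_fun_sym A k : symjet A -> jet_fun A (k := k) \in @sym_pred R G E k.
Proof.
move=> sA; apply/asboolP; split.
- move=> i v a x y; rewrite /jet_fun.
  have iE : perm_eq (enum 'I_k) (i :: rem i (enum 'I_k)).
    by apply: perm_to_rem; rewrite mem_enum.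
  have E1 u : A [seq replace_arg v i u j | j <- enum 'I_k] =
              A (u :: [seq v j | j <- rem i (enum 'I_k)]).
    rewrite (symjet_perm sA (perm_map _ iE))/= /replace_arg eqxx; congr (A (_ :: _)).
    apply/eq_in_map => j; rewrite mem_rem_uniq ?enum_uniq// inE => /andP[ji _].
    by rewrite (negbTE ji).
  by rewrite !E1 symjet_lin.
- move=> s v; rewrite /jet_fun; apply: (symjet_perm sA).
  rewrite (map_comp v s); apply: perm_map; apply: uniq_perm.
  + by rewrite map_inj_uniq ?enum_uniq//; exact: perm_inj.
  + exact: enum_uniq.
  + move=> i; rewrite mem_enum; apply/mapP; exists (s^-1%g i); first by rewrite mem_enum.
    by rewrite permKV.
- have [_ _ /(_ k)[M _ bM]] := sA; exists M => v.
  by rewrite -nprod_enum bM// size_map size_enum_ord.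
Qed.

Definition jet_sym A k (sA : symjet A) : SymL G E k := MkSymL (jet_fun_sym k sA).

Lemma sym_norm_leP k (S : SymL G E k) M : 0 <= M ->
  (forall v, `|S v| <= M * \prod_(i < k) `|v i|) -> `|S| <= M.
Proof.
move=> M0 bS; apply: ge_sup; first by have [] := sym_norm_has_sup S.
move=> _ [v v1 <-]; rewrite (le_trans (bS v))// ler_piMr//.
by rewrite prodr_ile1// => i _; rewrite normr_ge0 v1.
Qed.

(** Extended by 0 to lists of other lengths, a single symmetric map becomes a
    jet. *)
Definition sym_seq k (S : SymL G E k) (w : seq G) : E :=
  if size w == k then S (fun i => nth 0 w i) else 0.

Lemma map_nth_enum k (w : seq G) : size w = k ->
  [seq nth 0 w (i : 'I_k) | i <- enum 'I_k] = w.
Proof.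
move=> wk; rewrite (map_comp (nth 0 w) val) val_enum_ord.
by rewrite -wk; exact: mkseq_nth.
Qed.

Lemma nth_map_enum k (v : 'I_k -> G) :
  (fun i : 'I_k => nth 0 [seq v j | j <- enum 'I_k] i) = v.
Proof.
by apply/funext => i; rewrite (nth_map i) ?size_enum_ord// nth_ord_enum.
Qed.

Lemma sym_seqE k (S : SymL G E k) (v : 'I_k -> G) :
  sym_seq S [seq v i | i <- enum 'I_k] = S v.
Proof. by rewrite /sym_seq size_map size_enum_ord eqxx nth_map_enum. Qed.

Lemma sym_seq_le k (S : SymL G E k) w : `|sym_seq S w| <= `|S| * nprod w.
Proof.
rewrite /sym_seq; case: eqP => [wk|_]; last by rewrite normr0 mulr_ge0// nprod_ge0.
rewrite -[in nprod w](map_nth_enum wk) nprod_enum; exact: sym_norm_le.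
Qed.

Lemma sym_seq_linS k a (S S' : SymL G E k) w :
  sym_seq (a *: S + S') w = a *: sym_seq S w + sym_seq S' w.
Proof. by rewrite /sym_seq; case: eqP => // _; rewrite scaler0 addr0. Qed.

Lemma sym_seq_jet k (S : SymL G E k) : symjet (sym_seq S).
Proof.
have [mS sS _] := SymP S.
split=> [u w uw|w a x y|n].
- rewrite /sym_seq (perm_size uw); case: eqP => // wk.
  have uk : size u = k by rewrite (perm_size uw).
  have /tuple_permP[s us] : perm_eq u (Tuple (introT eqP wk)) by [].
  rewrite -(sS s (fun i => nth 0 w i)); congr (S _); apply/funext => i.
  rewrite us /= (nth_map i) ?size_enum_ord// nth_ord_enum.
  by rewrite (tnth_nth 0).
- rewrite /sym_seq; case: k S mS sS => [|k] S mS sS /=.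
    by rewrite scaler0 addr0.
  rewrite eqSS; case: eqP => [wk|]; last by rewrite scaler0 addr0.
  have E1 z : (fun i : 'I_k.+1 => nth 0 (z :: w) i) =
      replace_arg (fun i : 'I_k.+1 => nth 0 (0 :: w) i) ord0 z.
    apply/funext => i; rewrite /replace_arg; case: eqP => [->//|].
    by case: i => [[|i] ? /= i0]//; case: i0; exact: val_inj.
  by rewrite (E1 (a *: x + y)) (E1 x) (E1 y) mS.
- by exists `|S| => // w _; exact: sym_seq_le.
Qed.

End SymJet.

Section HasJet.
Variables (R : realType) (G E : normedModType R).
Variables (X : set G) (p : option nat).

(** The bounds in both limits are uniform over all directions, so that they
    express Frechet differentiability and continuity for the operator norm. *)
Record has_jet (f : G -> E) (J : G -> seq G -> E) : Prop := HasJet {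
  jet_out : forall x, ~ X x -> f x = 0;
  jet_symjet : forall x, symjet (J x);
  jet_nil : forall x, X x -> J x [::] = f x;
  jet_diff : forall k, in_Np p k.+1 -> forall x, X x -> forall e, 0 < e ->
    \forall h \near (0 : G),
      jet_le k (e * `|h|) (fun w => J (x + h) w - J x w - J x (h :: w));
  jet_cont : forall k, in_Np p k -> forall x, X x -> forall e, 0 < e ->
    \forall z \near x, jet_le k e (fun w => J z w - J x w) }.

Definition jet (f : G -> E) (x : G) (w : seq G) : E := sym_seq (Deriv (size w) f x) w.

Lemma jetE f x w : jet f x w = Deriv (size w) f x (fun i => nth 0 w i).
Proof. by rewrite /jet /sym_seq eqxx. Qed.

Lemma jet_le_Deriv f x w : `|jet f x w| <= `|Deriv (size w) f x| * nprod w.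
Proof. exact: sym_seq_le. Qed.

Lemma jet_map f x k (v : 'I_k -> G) :
  jet f x [seq v i | i <- enum 'I_k] = Deriv k f x v.
Proof. by rewrite -[RHS]sym_seqE /jet size_map size_enum_ord. Qed.

Hypothesis oX : open X.

Lemma jet_fun_cons (A : seq G -> E) k (v : 'I_k.+1 -> G) :
  jet_fun A v = A (v ord0 :: [seq v (lift ord0 i) | i <- enum 'I_k]).
Proof. by rewrite /jet_fun enum_ordSl/= -map_comp. Qed.

Lemma has_jet_step f J (sJ : forall x, symjet (J x)) k x : has_jet f J ->
  in_Np p k.+1 -> X x ->
  (forall z, X z -> Deriv k f z = jet_sym k (sJ z)) ->
  differentiable (Deriv k f) x /\
  uncurry_sym ('d (Deriv k f) x) = jet_fun (J x) (k := k.+1).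
Proof.
move=> fJ pk Xx DE.
pose L u : SymL G E k := jet_sym k (symjet_cons u (sJ x)).
have LE u v : L u v = J x (u :: [seq v i | i <- enum 'I_k]) by [].
have [_ _ /(_ k.+1)[M M0 bM]] := sJ x.
have [] := @frechet_differentiable _ _ _ (Deriv k f) L M x.
- by move=> a u v; apply/val_inj/funext => w /=; rewrite /jet_fun symjet_lin.
- move=> h; apply: sym_norm_leP; first exact: mulr_ge0.
  move=> v; rewrite LE -nprod_enum -mulrA -nprod_cons bM//=.
  by rewrite size_map size_enum_ord.
- move=> e e0; have := jet_diff fJ pk Xx e0.
  have : \forall h \near (0 : G), X (x + h).
    by apply/(nbhs0P X); exact: open_nbhs_nbhs.
  apply: filterS2 => h Xh bh; rewrite !DE//.
  apply: sym_norm_leP; first by rewrite mulr_ge0// ltW.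
  by move=> v; rewrite -nprod_enum; apply: bh; rewrite size_map size_enum_ord.
move=> dD dE; split => //; apply/funext => v.
by rewrite /uncurry_sym dE LE jet_fun_cons.
Qed.

(** The derivatives are determined one after the other, by uniqueness of the
    Frechet derivative; their symmetry comes from that of the jet. *)
Lemma has_jet_Deriv f J (sJ : forall x, symjet (J x)) : has_jet f J ->
  forall k, in_Np p k -> forall x, X x -> Deriv k f x = jet_sym k (sJ x).
Proof.
move=> fJ; elim=> [|k IH] pk x Xx; apply/val_inj.
  apply/funext => v /=; rewrite /jet_fun.
  have -> : [seq v i | i <- enum 'I_0] = [::].
    by apply: size0nil; rewrite size_map size_enum_ord.
  by rewrite (jet_nil fJ).
have [dD uE] := has_jet_step (sJ := sJ) fJ pk Xx (IH (in_NpS pk)).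
rewrite [LHS]DerivS uE//; exact: jet_fun_sym.
Qed.

Lemma has_jet_Cp f J : has_jet f J -> is_Cp X p f.
Proof.
move=> fJ; have sJ := jet_symjet fJ; have DJ := has_jet_Deriv sJ fJ.
split; first exact: jet_out fJ.
- move=> k pk x Xx.
  have [dD uE] := has_jet_step (sJ := sJ) fJ pk Xx (DJ k (in_NpS pk)).
  by split; rewrite ?uE//; exact: jet_fun_sym.
- move=> k pk; apply: continuous_in_subspaceT => x /set_mem Xx.
  apply/cvgrPdist_le => e e0; have := jet_cont fJ pk Xx e0.
  have : nbhs x X by exact: open_nbhs_nbhs.
  apply: filterS2 => z Xz bz; rewrite distrC !DJ//.
  apply: sym_norm_leP; first exact: ltW.
  by move=> v; rewrite -nprod_enum; apply: bz; rewrite size_map size_enum_ord.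
Qed.

Lemma has_jet_eq f J : has_jet f J ->
  forall x w, in_Np p (size w) -> X x -> jet f x w = J x w.
Proof.
move=> fJ x w pw Xx.
rewrite jetE (has_jet_Deriv (jet_symjet fJ) fJ)//=.
by rewrite /jet_fun map_nth_enum.
Qed.

Lemma near_forall_le (T : Type) (F : set_system T) (FF : Filter F)
    (P : nat -> set T) k : (forall j, (j <= k)%N -> F (P j)) ->
  F [set z | forall j, (j <= k)%N -> P j z].
Proof.
elim: k => [|k IH] Pk.
  by apply: filterS (Pk 0%N (leqnn _)) => z Pz [].
have := IH (fun j jk => Pk j (leqW jk)); have := Pk k.+1 (leqnn _).
apply: filterS2 => z P1 P2 j; rewrite leq_eqVlt => /orP[/eqP->//|]; exact: P2.
Qed.

Lemma in_Np_le k j : (j <= k)%N -> in_Np p k -> in_Np p j.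
Proof. by case: p => // n /=; exact: leq_trans. Qed.

Lemma jet_is_symjet f x : symjet (jet f x).
Proof.
split=> [u w uw|w a u v|n].
- by rewrite /jet (perm_size uw); exact: (symjet_perm (sym_seq_jet _)).
- by rewrite /jet /= symjet_lin//; exact: sym_seq_jet.
- exists (\sum_(j < n.+1) `|Deriv j f x|); first exact: sumr_ge0.
  move=> w wn; rewrite (le_trans (jet_le_Deriv _ _ _))// ler_wpM2r ?nprod_ge0//.
  by rewrite (bigD1 (Ordinal (wn : (size w < n.+1)%N)))//= lerDl sumr_ge0.
Qed.

Lemma Cp_has_jet f : is_Cp X p f -> has_jet f (jet f).
Proof.
case=> f0 df cf; split => //; first exact: jet_is_symjet.
- move=> k pk x Xx e e0.
  have H j : (j <= k)%N -> \forall h \near (0 : G),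
      `|Deriv j f (x + h) - Deriv j f x - 'd (Deriv j f) x h| <= e * `|h|.
    move=> jk; apply: differentiable_near => //.
    by have [] := df j (in_Np_le (jk : (j.+1 <= k.+1)%N) pk) x Xx.
  have {}H := near_forall_le (nbhs_filter (0 : G)) H.
  apply: (@filterS _ _ (nbhs_filter (0 : G)) _ _ _ H) => h {}H w wk.
  have pj : in_Np p (size w).+1 by exact: in_Np_le pk.
  rewrite (le_trans _ (ler_wpM2r (nprod_ge0 _) (H _ wk)))//.
  rewrite (le_trans _ (sym_seq_le _ w))// le_eqVlt; apply/orP; left; apply/eqP.
  congr `|_|; rewrite /sym_seq eqxx !jetE; congr (_ - _).
  by rewrite DerivS/uncurry_sym//; have [] := df _ pj x Xx.
- move=> k pk x Xx e e0.
  have H j : (j <= k)%N -> \forall z \near x, `|Deriv j f z - Deriv j f x| <= e.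
    move=> jk; have := cf j (in_Np_le jk pk).
    rewrite continuous_open_subspace// => /(_ x (mem_set Xx)).
    by move=> /cvgrPdist_le /(_ e e0); apply: filterS => z; rewrite distrC.
  have {}H := near_forall_le (nbhs_filter x) H.
  apply: (@filterS _ _ (nbhs_filter x) _ _ _ H) => z {}H w wk.
  rewrite (le_trans _ (ler_wpM2r (nprod_ge0 _) (H _ wk)))//.
  rewrite (le_trans _ (sym_seq_le _ w))// le_eqVlt; apply/orP; left; apply/eqP.
  by congr `|_|; rewrite /sym_seq eqxx !jetE.
Qed.

End HasJet.

(** * Bump functions, products and polynomials *)

Section Near.
Variables (R : realType) (V : normedModType R).

Lemma near_dist (x : V) (P : V -> Prop) :
  (\forall z \near x, P z) <->
  exists2 d : R, 0 < d & forall z, `|z - x| < d -> P z.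
Proof.
rewrite nbhs_normP; split=> -[d d0 dP]; exists d => // z.
  by move=> zx; apply: dP; rewrite /= distrC.
by rewrite /= distrC; exact: dP.
Qed.

Lemma near0_norm (P : V -> Prop) :
  (\forall z \near (0 : V), P z) <->
  exists2 d : R, 0 < d & forall z, `|z| < d -> P z.
Proof.
rewrite near_dist; split=> -[d d0 dP]; exists d => // z; have := dP z; by rewrite subr0.
Qed.

End Near.

Lemma exprn_le_1D (R : realType) (s : R) m n : 0 <= s -> (m <= n)%N ->
  s ^+ m <= (1 + s) ^+ n.
Proof.
move=> s0 mn; rewrite (@le_trans _ _ ((1 + s) ^+ m))//.
  by rewrite lerXn2r ?nnegrE ?addr_ge0// lerDr.
by rewrite ler_weXn2l// lerDl.
Qed.

Lemma product_increment (V : zmodType) (a b c d e f : V) :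
  a - d - (e + f) = (a - b - c) + (c - e) + (b - d - f).
Proof.
rewrite (addrA (a - b - c)) subrK (addrAC a (- b)) -[b - d - f]addrA (addrA (a - e - b)) subrK.
by rewrite opprD addrACA.
Qed.

Section Constructions.
Variables (R : realType) (G E : normedModType R) (p : option nat).

Lemma has_jet_patch (Z X : set G) (f : G -> E) J : X `<=` Z ->
  has_jet Z p f J -> has_jet X p (patch (fun=> 0) X f) J.
Proof.
move=> XZ [f0 sJ fN fD fC]; split => //.
- by move=> x Xx; rewrite /patch memNset//.
- by move=> x Xx; rewrite /patch mem_set// fN//; exact: XZ.
- by move=> k pk x Xx; apply: fD => //; exact: XZ.
- by move=> k pk x Xx; apply: fC => //; exact: XZ.
Qed.

(** With [A'], [B'] the jets at the displaced point, the remainder of the product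
    splits as [(A' - A - dA) B' + dA (B' - B) + A (B' - B - dB)], and each of
    the three terms is small. *)
Lemma has_jet_mul (Z X : set G) (g : G -> R) (f : G -> E) A B : X `<=` Z ->
  has_jet Z p g A -> has_jet X p f B ->
  has_jet X p (fun x => g x *: f x) (fun x => leib (A x) (B x)).
Proof.
move=> XZ gA fB; have [_ sA gN gD gC] := gA; have [f0 sB fN fD fC] := fB.
split.
- by move=> x Xx; rewrite f0// scaler0.
- by move=> x; exact: leib_symjet.
- by move=> x Xx /=; rewrite gN ?fN//; exact: XZ.
- move=> k pk x Xx e e0.
  have [_ _ /(_ k.+1)[a a0 bA]] := sA x; have [_ _ /(_ k.+1)[b b0 bB]] := sB x.
  pose c : R := 2 ^+ k * (b + 1 + 2 * a).
  have c0 : 0 < c.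
    by rewrite mulr_gt0 ?exprn_gt0// ltr_wpDr ?mulr_ge0// ltr_wpDl.
  pose d := Num.min 1 (e / c).
  have d0 : 0 < d by rewrite lt_min ltr01 divr_gt0.
  have dc : d * c <= e by rewrite -ler_pdivlMr// ge_min lexx orbT.
  have d1 : d <= 1 by rewrite ge_min lexx.
  have /near0_norm[r1 r10 hA] := gD k pk x (XZ _ Xx) d d0.
  have /near0_norm[r2 r20 hB] := fD k pk x Xx d d0.
  have /near_dist[r3 r30 hC] := fC k (in_NpS pk) x Xx d d0.
  apply/near0_norm; exists (Num.min r1 (Num.min r2 r3)).
    by rewrite !lt_min r10 r20.
  move=> h; rewrite !lt_min => /and3P[{}/hA hA {}/hB hB h3].
  have {}hC := hC (x + h); rewrite addrAC subrr add0r in hC; have {}hC := hC h3.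
  move=> w wk.
  have lA : jet_le k a (A x) by exact: jet_leW (leqnSn k) (lexx _) bA.
  have lAh := jet_le_cons h bA.
  have lBh : jet_le k (b + 1) (B (x + h)).
    move=> u uk; rewrite -(subrK (B x u) (B (x + h) u)) (le_trans (ler_normD _ _))//.
    rewrite addrC mulrDl mul1r lerD//; first by apply: bB; exact: leqW.
    by rewrite (le_trans (hC u uk))// ler_piMl// nprod_ge0.
  have -> : leib (A (x + h)) (B (x + h)) w - leib (A x) (B x) w -
      leib (A x) (B x) (h :: w) =
    leib (fun u => A (x + h) u - A x u - A x (h :: u)) (B (x + h)) w +
    leib (fun u => A x (h :: u)) (fun u => B (x + h) u - B x u) w +
    leib (A x) (fun u => B (x + h) u - B x u - B x (h :: u)) w.
    rewrite [leib _ _ (h :: w)]/=.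
    rewrite (leibBl (fun u => A (x + h) u - A x u)) (leibBl (A (x + h))).
    rewrite (leibBr (A x) (fun u => B (x + h) u - B x u)) !leibBr.
    exact: product_increment.
  rewrite (le_trans (ler_normD _ _))// (le_trans (lerD (ler_normD _ _) (lexx _)))//.
  have k1 := leib_le _ _ hA lBh wk; have k2 := leib_le _ _ lAh hC wk.
  have k3 := leib_le _ _ lA hB wk.
  rewrite (le_trans (lerD (lerD (k1 _ _) (k2 _ _)) (k3 _ _)))//.
  + by rewrite mulr_ge0// ltW.
  + by rewrite addr_ge0.
  + exact: mulr_ge0.
  + exact: ltW.
  + by rewrite mulr_ge0// ltW.
  rewrite -!mulrDl ler_wpM2r ?nprod_ge0//.
  rewrite [leLHS](_ : _ = d * c * `|h|); last by rewrite /c; ring.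
  by rewrite ler_wpM2r.
- move=> k pk x Xx e e0.
  have [_ _ /(_ k)[a a0 bA]] := sA x; have [_ _ /(_ k)[b b0 bB]] := sB x.
  pose c : R := 2 ^+ k * (b + 1 + a).
  have c0 : 0 < c.
    by rewrite mulr_gt0 ?exprn_gt0// ltr_wpDr ?mulr_ge0// ltr_wpDl.
  pose d := Num.min 1 (e / c).
  have d0 : 0 < d by rewrite lt_min ltr01 divr_gt0.
  have dc : d * c <= e by rewrite -ler_pdivlMr// ge_min lexx orbT.
  have d1 : d <= 1 by rewrite ge_min lexx.
  have /near_dist[r1 r10 hA] := gC k pk x (XZ _ Xx) d d0.
  have /near_dist[r2 r20 hB] := fC k pk x Xx d d0.
  apply/near_dist; exists (Num.min r1 r2); first by rewrite !lt_min r10 r20.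
  move=> z; rewrite !lt_min => /andP[{}/hA hA {}/hB hB] w wk.
  have lBh : jet_le k (b + 1) (B z).
    move=> u uk; rewrite -(subrK (B x u) (B z u)) (le_trans (ler_normD _ _))//.
    rewrite addrC mulrDl mul1r lerD//; first by apply: bB.
    by rewrite (le_trans (hB u uk))// ler_piMl// nprod_ge0.
  have -> : leib (A z) (B z) w - leib (A x) (B x) w =
    leib (fun u => A z u - A x u) (B z) w +
    leib (A x) (fun u => B z u - B x u) w.
    by rewrite leibBl leibBr addrA subrK.
  rewrite (le_trans (ler_normD _ _))//.
  have k1 := leib_le _ _ hA lBh wk; have k2 := leib_le _ _ bA hB wk.
  rewrite (le_trans (lerD (k1 _ _) (k2 _ _)))//.
  + exact: ltW.
  + by rewrite addr_ge0.
  + exact: ltW.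
  rewrite -!mulrDl ler_wpM2r ?nprod_ge0//.
  by rewrite [leLHS](_ : _ = d * c)//; rewrite /c; ring.
Qed.

(** Each differentiation in a direction [v] produces [s *: v] by the chain rule,
    hence a factor [s] per entry of the list. *)
Lemma has_jet_dilate (g : G -> E) J (c : G) (s : R) : 0 < s ->
  has_jet setT p g J ->
  has_jet setT p (fun x => g (s *: (x - c)))
    (fun x w => s ^+ size w *: J (s *: (x - c)) w).
Proof.
move=> s0 [_ sJ gN gD gC]; split.
- by move=> x [].
- move=> x; split=> [u w uw|w a u v|n].
  + by rewrite (perm_size uw) (symjet_perm (sJ _) uw).
  + by rewrite /= symjet_lin// scalerDr !scalerA mulrC.
  + have [_ _ /(_ n)[a a0 bJ]] := sJ (s *: (x - c)); exists ((1 + s) ^+ n * a).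
      by rewrite mulr_ge0// exprn_ge0// addr_ge0// ltW.
    move=> w wn; rewrite normrZ -mulrA ler_pM//; last exact: bJ.
    rewrite ger0_norm ?exprn_ge0 ?(ltW s0)//.
    exact: exprn_le_1D (ltW s0) wn.
- by move=> x _; rewrite expr0 scale1r gN.
- move=> k pk x _ e e0.
  have s1 : 0 < s * (1 + s) ^+ k by rewrite mulr_gt0// exprn_gt0// addr_gt0.
  have /near0_norm[d d0 hd] := gD k pk (s *: (x - c)) I _ (divr_gt0 e0 s1).
  apply/near0_norm; exists (d / s); first exact: divr_gt0.
  move=> h hds w wk.
  have sh : `|s *: h| < d by rewrite normrZ gtr0_norm// mulrC -ltr_pdivlMr.
  have /= := hd _ sh w wk.
  rewrite -scalerDr (addrAC x (- c)) => H.
  rewrite exprS (mulrC s) -scalerA -symjetZ// -!scalerBr normrZ ger0_norm ?exprn_ge0 ?(ltW s0)//.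
  rewrite (le_trans (ler_wpM2l _ H)) ?exprn_ge0 ?(ltW s0)//.
  rewrite mulrA ler_wpM2r ?nprod_ge0// normrZ gtr0_norm// !mulrA ler_wpM2r//.
  have sk := exprn_le_1D (ltW s0) wk.
  rewrite [leLHS](_ : _ = s ^+ size w / (1 + s) ^+ k * e).
    by rewrite ler_piMl ?(ltW e0)// ler_pdivrMr ?mul1r// exprn_gt0// addr_gt0.
  have : (1 + s) ^+ k != 0 by rewrite gt_eqF// exprn_gt0// addr_gt0.
  by move: (_ ^+ k) => q q0; field; rewrite q0 gt_eqF.
- move=> k pk x _ e e0.
  have s1 : 0 < (1 + s) ^+ k by rewrite exprn_gt0// addr_gt0.
  have /near_dist[d d0 hd] := gC k pk (s *: (x - c)) I _ (divr_gt0 e0 s1).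
  apply/near_dist; exists (d / s); first exact: divr_gt0.
  move=> z hds w wk.
  have sz : `|s *: (z - c) - s *: (x - c)| < d.
    by rewrite -scalerBr opprB addrA subrK normrZ gtr0_norm// mulrC -ltr_pdivlMr.
  have /= H := hd _ sz w wk.
  have sk := exprn_le_1D (ltW s0) wk.
  rewrite -scalerBr normrZ ger0_norm ?exprn_ge0 ?(ltW s0)//.
  rewrite (le_trans (ler_wpM2l _ H)) ?exprn_ge0 ?(ltW s0)//.
  rewrite mulrA ler_wpM2r ?nprod_ge0// mulrCA ler_piMr ?(ltW e0)//.
  by rewrite ler_pdivrMr ?mul1r.
Qed.

End Constructions.

Section Powers.
Variables (R : realType) (G E : normedModType R).
Implicit Types (B : seq G -> E).

Lemma pow_lip B m b r z z' : symjet B -> 0 <= b -> 1 <= r ->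
  (forall w, size w = m -> `|B w| <= b * nprod w) -> `|z| <= r -> `|z'| <= r ->
  `|B (nseq m z') - B (nseq m z)| <= m%:R * (b * `|z' - z|) * r ^+ m.
Proof.
move=> sB b0 r1 bB zr z'r; have r0 : 0 <= r by exact: le_trans r1.
elim: m b B b0 sB bB => [|m IH] b B b0 sB bB /=.
  by rewrite subrr normr0 !mul0r.
have -> : B (z' :: nseq m z') - B (z :: nseq m z) = B (z' - z :: nseq m z') +
   (B (z :: nseq m z') - B (z :: nseq m z)).
  by rewrite -{1}(subrK z z') symjetD// addrA.
rewrite (le_trans (ler_normD _ _))//.
have k1 : `|B (z' - z :: nseq m z')| <= b * `|z' - z| * r ^+ m.+1.
  rewrite (le_trans (bB _ _))//= ?size_nseq// nprod_cons nprod_nseq mulrA.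
  rewrite ler_wpM2l ?mulr_ge0// exprS (le_trans (lerXn2r m _ _ z'r)) ?nnegrE//.
  by rewrite ler_peMl// exprn_ge0.
have k2 : `|B (z :: nseq m z') - B (z :: nseq m z)| <=
    m%:R * (b * r * `|z' - z|) * r ^+ m.
  rewrite (le_trans (IH (b * `|z|) (fun w => B (z :: w)) _ _ _))//.
  - exact: mulr_ge0.
  - exact: symjet_cons.
  - by move=> w wm; rewrite -mulrA -nprod_cons bB//= wm.
  - by rewrite ler_wpM2r ?exprn_ge0// ler_wpM2l// ler_wpM2r// ler_wpM2l.
rewrite (le_trans (lerD k1 k2))// exprS -natr1.
by rewrite [leLHS](_ : _ = (m%:R + 1) * (b * `|z' - z|) * (r * r ^+ m))//; ring.
Qed.

(** Peeling off one argument, the increment of [B (z, ..., z)] is that of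
    [B (z, ...)] in one argument less, plus [B (z' - z, ...)], which is the
    linear part up to a term controlled by [pow_lip]. *)
Lemma pow_diff B m b r z z' : symjet B -> 0 <= b -> 1 <= r ->
  (forall w, size w = m.+1 -> `|B w| <= b * nprod w) -> `|z| <= r -> `|z'| <= r ->
  `|B (nseq m.+1 z') - B (nseq m.+1 z) - m.+1%:R *: B (z' - z :: nseq m z)| <=
    m.+1%:R ^+ 2 * (b * `|z' - z| ^+ 2) * r ^+ m.+1.
Proof.
move=> sB b0 r1 bB zr z'r; have r0 : 0 <= r by exact: le_trans r1.
elim: m b B b0 sB bB => [|m IH] b B b0 sB bB.
  rewrite /= -{1}(subrK z z') symjetD// addrK scale1r subrr normr0.
  by rewrite !mulr_ge0// exprn_ge0.
have -> : B (nseq m.+2 z') - B (nseq m.+2 z) - m.+2%:R *: B (z' - z :: nseq m.+1 z) =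
  (B (z' - z :: nseq m.+1 z') - B (z' - z :: nseq m.+1 z)) +
  (B (z :: nseq m.+1 z') - B (z :: nseq m.+1 z) -
     m.+1%:R *: B (z :: z' - z :: nseq m z)).
  rewrite -[nseq m.+2 z']/(z' :: nseq m.+1 z') -{1}(subrK z z') symjetD//.
  rewrite -[nseq m.+2 z]/(z :: nseq m.+1 z) -natr1 scalerDl scale1r.
  rewrite (symjet_swap z (z' - z))//.
  have zm (a a' c x y : E) : a + a' - c - (y + x) = (a - x) + (a' - c - y).
    by rewrite addrACA -opprD (addrC x) addrA.
  exact: zm.
rewrite (le_trans (ler_normD _ _))//.
have k1 := @pow_lip (fun w => B (z' - z :: w)) m.+1 (b * `|z' - z|) r z z'
  (symjet_cons _ sB) (mulr_ge0 b0 (normr_ge0 _)) r1.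
have {}k1 : `|B (z' - z :: nseq m.+1 z') - B (z' - z :: nseq m.+1 z)| <=
    m.+1%:R * (b * `|z' - z| ^+ 2) * (r * r ^+ m.+1).
  rewrite (le_trans (k1 _ zr z'r))//.
    by move=> w wm; rewrite -mulrA -nprod_cons bB//= wm.
  rewrite -(mulrA b) -expr2 ler_wpM2l ?mulr_ge0// ?exprn_ge0//.
  by rewrite ler_peMl// exprn_ge0.
have k2 := IH (b * r) (fun w => B (z :: w)) (mulr_ge0 b0 r0) (symjet_cons _ sB).
have bz w : size w = m.+1 -> `|B (z :: w)| <= b * r * nprod w.
  move=> wm; rewrite (le_trans (bB _ _)) /= ?wm// nprod_cons mulrA.
  by rewrite ler_wpM2r ?nprod_ge0// ler_wpM2l.
rewrite (le_trans (lerD k1 (k2 bz)))//.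
rewrite [leLHS](_ : _ = (m.+1%:R + m.+1%:R ^+ 2) * (b * `|z' - z| ^+ 2) *
    r ^+ m.+2); last by rewrite (exprS r m.+1); ring.
rewrite ler_wpM2r ?exprn_ge0// ler_wpM2r ?mulr_ge0 ?exprn_ge0//.
by rewrite -[m.+2%:R]natr1; have : 0 <= m.+1%:R :> R by []; nra.
Qed.

End Powers.

Section Polynomials.
Variables (R : realType) (G E : normedModType R) (k : nat).
Implicit Types (S : SymL G E k) (c x : G).

(** The jet at [x] of the homogeneous polynomial [S (x - c, ..., x - c) / k!],
    whose [k]-th derivative is [S] and whose other derivatives vanish at [c]. *)
Definition pjet S c x (w : seq G) : E :=
  ((k - size w)`!%:R)^-1 *: sym_seq S (w ++ nseq (k - size w) (x - c)).

Lemma invfact_ge0 n : 0 <= (n`!%:R)^-1 :> R. Proof. by rewrite invr_ge0. Qed.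

Lemma invfact_le1 n : (n`!%:R)^-1 <= 1 :> R.
Proof. by rewrite invf_le1 ?ltr0n ?fact_gt0// ler1n fact_gt0. Qed.

Lemma pjet_le S c x r w : 1 <= r -> `|x - c| <= r ->
  `|pjet S c x w| <= `|S| * r ^+ k * nprod w.
Proof.
move=> r1 xr; have r0 : 0 <= r by exact: le_trans r1.
rewrite /pjet normrZ ger0_norm ?invfact_ge0//.
rewrite (le_trans (ler_piMl _ (invfact_le1 _)))// (le_trans (sym_seq_le _ _))//.
rewrite nprod_cat nprod_nseq -mulrA ler_wpM2l// mulrC ler_wpM2r ?nprod_ge0//.
rewrite (le_trans (lerXn2r _ _ _ xr)) ?nnegrE//.
by rewrite ler_weXn2l// leq_subr.
Qed.

Lemma pjet_lip S c c' x x' r w : 1 <= r -> `|x - c| <= r -> `|x' - c'| <= r ->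
  `|pjet S c' x' w - pjet S c x w| <=
    k%:R * (`|S| * `|(x' - c') - (x - c)|) * r ^+ k * nprod w.
Proof.
move=> r1 xr xr'; have r0 : 0 <= r by exact: le_trans r1.
rewrite /pjet -scalerBr normrZ ger0_norm ?invfact_ge0//.
rewrite (le_trans (ler_piMl _ (invfact_le1 _)))//.
have := @pow_lip _ _ _ (fun u => sym_seq S (w ++ u)) (k - size w)
  (`|S| * nprod w) r (x - c) (x' - c') (symjet_cat w (sym_seq_jet S)).
move=> /(_ _ _ _ _ _)/le_trans; apply => //.
- by rewrite mulr_ge0// nprod_ge0.
- by move=> u _; rewrite -mulrA -nprod_cat sym_seq_le.
- rewrite [leRHS](_ : _ = k%:R * (`|S| * nprod w * `|x' - c' - (x - c)|) * r ^+ k).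
    rewrite ler_pM ?mulr_ge0 ?exprn_ge0 ?nprod_ge0//.
      by rewrite ler_wpM2r ?mulr_ge0 ?nprod_ge0// ler_nat leq_subr.
    by rewrite ler_weXn2l// leq_subr.
  by ring.
Qed.

Lemma pjet_symjet S c x : symjet (pjet S c x).
Proof.
have sS := sym_seq_jet S; split=> [u w uw|w a u v|n].
- by rewrite /pjet (perm_size uw); congr (_ *: _); apply: (symjet_perm sS); rewrite perm_cat2r.
- by rewrite /pjet /= symjet_lin// scalerDr !scalerA mulrC.
- exists (`|S| * (`|x - c| + 1) ^+ k).
    by rewrite mulr_ge0// exprn_ge0// addr_ge0.
  by move=> w _; apply: pjet_le; rewrite ?lerDl ?lerDr.
Qed.

Lemma pjet_lin a S S' c x w :
  pjet (a *: S + S') c x w = a *: pjet S c x w + pjet S' c x w.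
Proof. by rewrite /pjet sym_seq_linS scalerDr !scalerA mulrC. Qed.

Lemma pjet_center S c w : pjet S c c w = sym_seq S w.
Proof.
rewrite /pjet subrr; have [wk|wk] := leqP k (size w).
  by rewrite (eqP (_ : k - size w == 0)%N) ?subn_eq0// cats0 fact0 invr1 scale1r.
have -> : sym_seq S w = 0 by rewrite /sym_seq ltn_eqF.
rewrite (symjet_perm (sym_seq_jet S) (_ : perm_eq _ (nseq (k - size w) 0 ++ w))).
  by case: (k - size w)%N (subn_gt0 (size w) k) => [|n] //; rewrite ?wk// /= symjet_head0 ?scaler0//; exact: sym_seq_jet.
by rewrite perm_catC.
Qed.

Lemma has_jet_poly S c p :
  has_jet setT p (fun x => pjet S c x [::]) (pjet S c).
Proof.
split => //.
- by move=> x [].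
- exact: pjet_symjet.
- move=> n _ x _ e e0.
  pose r := `|x - c| + 1; have r1 : 1 <= r by rewrite lerDr.
  have r0 : 0 <= r by exact: le_trans r1.
  pose a := k%:R ^+ 2 * `|S| * r ^+ k.
  have a0 : 0 <= a by rewrite !mulr_ge0// exprn_ge0.
  apply/near0_norm; exists (Num.min 1 (e / (a + 1))).
    by rewrite lt_min ltr01 divr_gt0// ltr_wpDl.
  move=> h; rewrite lt_min => /andP[h1 he] w _.
  have {}he : a * `|h| <= e.
    rewrite ltr_pdivlMr ?ltr_wpDl// in he; rewrite (le_trans _ (ltW he))// mulrC.
    by rewrite ler_wpM2l// lerDl.
  have [wk|wk] := leqP k (size w).
    have -> : pjet S c x (h :: w) = 0.
      rewrite /pjet /sym_seq /= size_cat size_nseq gtn_eqF ?scaler0//.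
      by rewrite ltnS (leq_trans wk)// leq_addr.
    rewrite /pjet (eqP (_ : k - size w == 0)%N) ?subn_eq0//= subrr subr0 normr0.
    by rewrite !mulr_ge0 ?nprod_ge0// ltW.
  rewrite /pjet /= subnS; have : (0 < k - size w)%N by rewrite subn_gt0.
  have : (k - size w <= k)%N by exact: leq_subr.
  case: (k - size w)%N => // m mk _; rewrite succnK.
  have -> : sym_seq S (h :: w ++ nseq m (x - c)) = sym_seq S (w ++ h :: nseq m (x - c)).
    by apply: (symjet_perm (sym_seq_jet S)); rewrite -[h :: w ++ _]/([:: h] ++ w ++ _) perm_catCA.
  have -> : (m`!%:R)^-1 = ((m.+1)`!%:R)^-1 * m.+1%:R :> R.
    by rewrite factS natrM invfM mulrAC mulVf ?mul1r.
  rewrite -scalerA -!scalerBr normrZ ger0_norm ?invfact_ge0//.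
  rewrite (le_trans (ler_piMl _ (invfact_le1 _)))//.
  have := @pow_diff _ _ _ (fun u => sym_seq S (w ++ u)) m
    (`|S| * nprod w) r (x - c) (x + h - c) (symjet_cat w (sym_seq_jet S)).
  have -> : x + h - c - (x - c) = h.
    by rewrite (addrAC x h) (addrAC (x - c)) subrr add0r.
  move=> /(_ _ r1 _ _ _)/le_trans; apply.
  - by rewrite mulr_ge0// nprod_ge0.
  - by move=> u _; rewrite -mulrA -nprod_cat sym_seq_le.
  - by rewrite lerDl.
  - by rewrite addrAC (le_trans (ler_normD _ _))// lerD// ltW.
  rewrite [leLHS](_ : _ = (m.+1%:R ^+ 2 * `|S| * r ^+ m.+1 * `|h|) * (`|h| * nprod w)).
    rewrite -[leRHS]mulrA ler_wpM2r ?mulr_ge0 ?nprod_ge0//.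
    rewrite (le_trans _ he)// ler_wpM2r//.
    rewrite ler_pM ?mulr_ge0 ?exprn_ge0//; last by rewrite ler_weXn2l.
    by rewrite ler_wpM2r// lerXn2r ?nnegrE// ler_nat.
  by ring.
- move=> n _ x _ e e0.
  pose r := `|x - c| + 1; have r1 : 1 <= r by rewrite lerDr.
  have r0 : 0 <= r by exact: le_trans r1.
  pose a := k%:R * `|S| * r ^+ k.
  have a0 : 0 <= a by rewrite !mulr_ge0// exprn_ge0.
  apply/near_dist; exists (Num.min 1 (e / (a + 1))).
    by rewrite lt_min ltr01 divr_gt0// ltr_wpDl.
  move=> z; rewrite lt_min => /andP[h1 he] w _.
  have {}he : a * `|z - x| <= e.
    rewrite ltr_pdivlMr ?ltr_wpDl// in he; rewrite (le_trans _ (ltW he))// mulrC.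
    by rewrite ler_wpM2l// lerDl.
  have zc : z - c - (x - c) = z - x by rewrite opprB addrA subrK.
  rewrite (le_trans (@pjet_lip S c c x z r w r1 _ _)) ?lerDl//.
    rewrite -(subrK (x - c) (z - c)) zc addrC (le_trans (ler_normD _ _))//.
    by rewrite lerD// ltW.
  rewrite zc ler_wpM2r ?nprod_ge0// (le_trans _ he)//.
  by rewrite [leLHS](_ : _ = a * `|z - x|)// /a; ring.
Qed.

End Polynomials.

(** * Taylor estimates *)

Section MeanValue.
Variables (R : realType) (V : normedModType R).

(** The set of times up to which [|g t - g 0|] grows at rate at most [M + e] is
    closed, and by the local estimate it cannot end before time 1. *)
Lemma mean_value (g : R -> V) (M : R) :
  (forall t, 0 <= t <= 1 -> forall e, 0 < e ->
    exists2 d, 0 < d & forall s, `|s - t| < d -> `|g s - g t| <= (M + e) * `|s - t|) ->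
  `|g 1 - g 0| <= M.
Proof.
move=> gM; apply/ler_addgt0Pr => e e0.
pose A := [set t : R | 0 <= t <= 1 /\
  forall s, 0 <= s <= t -> `|g s - g 0| <= (M + e) * s].
have A0 : A 0.
  split=> [|s /andP[s0 s0']]; first by rewrite lexx ler01.
  by have /eqP -> : s == 0; rewrite ?eq_le ?s0' ?s0// subrr normr0 mulr0.
have A1 : ubound A 1 by move=> t [/andP[]].
have supA : has_sup A by split; [exists 0|exists 1].
pose T := sup A.
have T0 : 0 <= T by apply: ub_le_sup => //; exists 1.
have T1 : T <= 1 by apply: ge_sup => //; exists 0.
have [d d0 gd] := gM T (introT andP (conj T0 T1)) e e0.
have AT s : 0 <= s <= T -> `|g s - g 0| <= (M + e) * s.
  move=> /andP[s0]; rewrite le_eqVlt => /orP[/eqP ->|sT]; last first.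
    have sTd : 0 < T - s by rewrite subr_gt0.
    have [a [_ Aa]] := sup_adherent sTd supA.
    by rewrite -/T subKr => /ltW sa; apply: Aa; rewrite s0.
  have [a Aa] := sup_adherent d0 supA; rewrite -/T => Tda.
  have aT : a <= T by apply: ub_le_sup => //; exists 1.
  have [/andP[a0 _] /(_ a)] := Aa; rewrite a0 lexx => /(_ isT) ga.
  have := gd a; rewrite distrC ger0_norm ?subr_ge0// => /(_ _) H.
  have {}H : `|g a - g T| <= (M + e) * (T - a).
    by apply: H; rewrite ltrBlDl -ltrBlDr.
  rewrite -(subrK (g a) (g T)) -addrA (le_trans (ler_normD _ _))// distrC.
  by rewrite (le_trans (lerD H ga))// -mulrDr subrK.
have [T1'|T1'] := ltP T 1; last first.
  have T1E : T = 1 by apply/eqP; rewrite eq_le T1.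
  by have := AT 1; rewrite ler01 T1E lexx mulr1; exact.
pose T' := Num.min 1 (T + d / 2).
have d2 : 0 < d / 2 by rewrite divr_gt0.
have TT' : T < T' by rewrite lt_min T1' ltrDl.
suff AT' : A T'.
  have : T' <= T by apply: ub_le_sup => //; exists 1.
  by rewrite leNgt TT'.
split=> [|s /andP[s0 sT']].
  by rewrite (ltW (le_lt_trans T0 TT')) ge_min lexx.
have [sT|Ts] := leP s T; first by apply: AT; rewrite s0.
have sTd : s - T < d.
  rewrite ltrBlDl (le_lt_trans sT')// (@le_lt_trans _ _ (T + d / 2))//.
    by rewrite ge_min lexx orbT.
  by rewrite ltrD2l ltr_pdivrMr// mulr_natr mulr2n ltrDl.
have := gd s; rewrite gtr0_norm ?subr_gt0// => /(_ sTd) H.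
have := AT T; rewrite T0 lexx => /(_ isT) gT.
rewrite -(subrK (g T) (g s)) -addrA (le_trans (ler_normD _ _))//.
by rewrite (le_trans (lerD H gT))// -mulrDr subrK.
Qed.

End MeanValue.

Section Taylor.
Variables (R : realType) (G E : normedModType R).

(** Taylor's estimate for a jet vanishing at [c] up to order [n], by descending
    induction on the order: at order [n] it is continuity, and a bound on the
    derivative of order [j + 1] gives one of order [j] along the segment from
    [c] to [x]. *)
Lemma jet_small (X : set G) p (f : G -> E) J c n e : open X ->
  has_jet X p f J -> X c -> in_Np p n ->
  (forall w, (size w <= n)%N -> J c w = 0) -> 0 < e ->
  exists2 d, 0 < d & forall x, `|x - c| < d -> X x /\
    forall w, (size w <= n)%N -> `|J x w| <= e * `|x - c| ^+ (n - size w) * nprod w.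
Proof.
move=> oX fJ Xc pn Jc e0.
have /near_dist[d1 d10 h1] := jet_cont fJ pn Xc e0.
have /near_dist[d2 d20 h2] : \forall z \near c, X z by exact: open_nbhs_nbhs.
exists (Num.min d1 d2); first by rewrite lt_min d10.
pose d := Num.min d1 d2.
have bX x : `|x - c| < d -> X x by rewrite lt_min => /andP[_]; exact: h2.
suff H m w : (size w + m)%N = n -> forall x, `|x - c| < d ->
    `|J x w| <= e * `|x - c| ^+ m * nprod w.
  move=> x xd; split; first exact: bX.
  by move=> w wn; apply: H => //; rewrite subnKC.
(* [m] is the number of derivatives still available above those taken in [w]. *)
elim: m w => [|m IH] w wn x xd.
  rewrite addn0 in wn; rewrite expr0 mulr1.
  have := h1 x; rewrite (lt_le_trans xd) ?ge_min ?lexx// => /(_ isT w).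
  by rewrite wn leqnn Jc ?wn// subr0; exact.
pose z t := c + t *: (x - c).
have z1 : z 1 = x by rewrite /z scale1r addrC subrK.
have z0 : z 0 = c by rewrite /z scale0r addr0.
have := @mean_value _ _ (fun t => J (z t) w) (e * `|x - c| ^+ m.+1 * nprod w).
rewrite z1 z0 Jc ?subr0; last by rewrite -wn leq_addr.
apply=> t /andP[t0 t1] e' e'0.
have ztc : `|z t - c| <= `|x - c|.
  by rewrite /z addrAC subrr add0r normrZ ger0_norm// ler_piMl.
have ztd : `|z t - c| < d by exact: le_lt_trans xd.
have pw : in_Np p (size w).+1.
  by apply: in_Np_le pn; rewrite -wn addnS ltnS leq_addr.
have q0 : 0 < `|x - c| * nprod w + 1 by rewrite ltr_wpDl// mulr_ge0// nprod_ge0.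
have /near0_norm[r r0 hr] := jet_diff fJ pw (bX _ ztd) (divr_gt0 e'0 q0).
have xc1 : 0 < `|x - c| + 1 by rewrite ltr_wpDl.
exists (r / (`|x - c| + 1)); first exact: divr_gt0.
move=> s; rewrite ltr_pdivlMr// => str.
have zs : z s = z t + (s - t) *: (x - c).
  by rewrite /z scalerBl -addrA; congr (_ + _); rewrite addrC subrK.
have := hr ((s - t) *: (x - c)).
rewrite normrZ (le_lt_trans _ str); last by rewrite ler_wpM2l// lerDl.
move=> /(_ isT w (leqnn _)); rewrite -zs symjetZ; last exact: (jet_symjet fJ).
move=> H; rewrite -(subrK ((s - t) *: J (z t) (x - c :: w)) (J (z s) w - _)).
rewrite (le_trans (ler_normD _ _))// mulrDl addrC lerD//.
  rewrite normrZ mulrC ler_wpM2r// (le_trans (IH (x - c :: w) _ _ ztd)) ?addSnnS//.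
  rewrite nprod_cons mulrA ler_wpM2r ?nprod_ge0// exprSr mulrA ler_wpM2r//.
  by rewrite ler_wpM2l ?(ltW e0)// lerXn2r ?nnegrE.
rewrite (le_trans H)//.
rewrite [leLHS](_ : _ = e' * `|s - t| * ((`|x - c| * nprod w) / (`|x - c| * nprod w + 1))).
  rewrite ler_piMr ?mulr_ge0// ?(ltW e'0)// ler_pdivrMr// mul1r.
  by rewrite lerDl.
by field; rewrite gt_eqF.
Qed.

Lemma Deriv_near0 (U : set G) (f : G -> E) k x : open U ->
  (forall z, U z -> f z = 0) -> U x -> Deriv k f x = 0.
Proof.
move=> oU f0; elim: k x => [|k IH] x Ux.
  by apply/val_inj/funext => v /=; exact: f0.
have nE : {near x, cst 0 =1 Deriv k f}.
  have : nbhs x U by exact: open_nbhs_nbhs.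
  by apply: filterS => z Uz; rewrite IH.
have [_ dE] := near_eq_diff nE (differentiable_cst 0 x).
have u0 : uncurry_sym ('d (Deriv k f) x) = 0.
  by apply/funext => v; rewrite /uncurry_sym dE diff_cst.
have s0 : uncurry_sym ('d (Deriv k f) x) \in @sym_pred R G E k.+1.
  by rewrite u0; exact: rpred0.
by apply: val_inj; rewrite [LHS](DerivS s0) u0.
Qed.

End Taylor.

(** * The spaces of C^p functions and their topology *)

Section CpElements.
Variables (R : realType) (G E : normedModType R) (X : set G) (oX : open X).
Variable p : option nat.
Implicit Types f g : Cp oX p E.

Lemma CpP f : is_Cp X p f.
Proof. by case: f => f /= /asboolP. Qed.

Lemma is_Cp_mem (f : G -> E) : is_Cp X p f -> f \in Cp_pred oX p.
Proof. by move=> ?; apply/asboolP. Qed.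

Definition mkCp (f : G -> E) (Cf : is_Cp X p f) : Cp oX p E := MkCp (is_Cp_mem Cf).

Lemma Cp_jet f : has_jet X p f (jet f).
Proof. exact: Cp_has_jet oX _ (CpP f). Qed.

Lemma Cp_out f x : ~ X x -> f x = 0.
Proof. exact: (jet_out (Cp_jet f)). Qed.

Lemma Deriv_CpD a f g k x : in_Np p k -> X x ->
  Deriv k (a *: f + g) x = a *: Deriv k f x + Deriv k g x.
Proof. by move=> pk Xx; have [] := Deriv_linear a oX (CpP f) (CpP g) pk Xx. Qed.

Lemma Deriv_CpB f g k x : in_Np p k -> X x ->
  Deriv k (f - g) x = Deriv k f x - Deriv k g x.
Proof.
move=> pk Xx; have -> : f - g = -1 *: g + f by rewrite scaleN1r addrC.
by rewrite Deriv_CpD// scaleN1r addrC.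
Qed.

Lemma Deriv_CpZ a f k x : in_Np p k -> X x ->
  Deriv k (a *: f) x = a *: Deriv k f x.
Proof.
move=> pk Xx; have -> : a *: f = a *: f + 0 :> Cp oX p E by rewrite addr0.
by rewrite Deriv_CpD// Deriv_cst0 addr0.
Qed.

Lemma Deriv_Cp_sum (I : Type) (s : seq I) (P : pred I) (F : I -> Cp oX p E) k x :
  in_Np p k -> X x ->
  Deriv k (\sum_(i <- s | P i) F i) x = \sum_(i <- s | P i) Deriv k (F i) x.
Proof.
move=> pk Xx; elim: s => [|i s IH]; first by rewrite !big_nil Deriv_cst0.
rewrite !big_cons; case: (P i) => //.
by rewrite -[F i]scale1r Deriv_CpD// IH !scale1r.
Qed.

Lemma Cp_sumE n (f : nat -> Cp oX p E) x :
  (\sum_(0 <= i < n) f i) x = \sum_(0 <= i < n) f i x.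
Proof.
elim: n => [|n IH]; first by rewrite !big_geq.
by rewrite !big_nat_recr//= -IH.
Qed.

Lemma Deriv_continuous f k : in_Np p k -> {within X, continuous (Deriv k f)}.
Proof. by have [_ _] := CpP f; apply. Qed.

Lemma Cp_near f x e : X x -> 0 < e -> \forall z \near x, `|f z - f x| <= e.
Proof.
move=> Xx e0.
have p0 : in_Np p 0 by case: (p).
have XN : \forall z \near x, X z by exact: open_nbhs_nbhs.
near=> z; have Xz : X z by near: z.
have : jet_le 0 e (fun w => jet f z w - jet f x w).
  by near: z; exact: (jet_cont (Cp_jet f) p0 Xx e0).
move=> /(_ [::] (leqnn _)).
by rewrite !(jet_nil (Cp_jet f))// nprod_nil mulr1.
Unshelve. all: by end_near. Qed.

Lemma Cp_bounded f (K : set G) k : compact K -> K `<=` X -> in_Np p k ->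
  exists2 M, 0 <= M & forall x j, K x -> (j <= k)%N -> `|Deriv j f x| <= M.
Proof.
move=> cK KX; elim: k => [|k IH] pk.
  have /compact_bounded[M [_ bM]] : compact (Deriv 0 f @` K).
    apply: continuous_compact => //.
    by apply: (continuous_subspaceW KX); exact: Deriv_continuous.
  exists (`|M| + 1) => [|x j Kx]; first exact: addr_ge0.
  rewrite leqn0 => /eqP ->; apply: bM; last by exists x.
  by rewrite ltr_pwDr// ler_norm.
have [N N0 bN] := IH (in_NpS pk).
have /compact_bounded[M [_ bM]] : compact (Deriv k.+1 f @` K).
  apply: continuous_compact => //.
  by apply: (continuous_subspaceW KX); exact: Deriv_continuous.
exists (N + (`|M| + 1)) => [|x j Kx]; first by rewrite !addr_ge0.
rewrite leq_eqVlt => /orP[/eqP->|]; last first.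
  by rewrite ltnS => jk; rewrite (le_trans (bN x j Kx jk))// lerDl addr_ge0.
rewrite (@le_trans _ _ (`|M| + 1)) ?lerDr//; apply: bM; last by exists x.
by rewrite ltr_pwDr// ler_norm.
Qed.

Lemma rho_le f K k M : 0 <= M ->
  (forall x j, K x -> (j <= k)%N -> `|Deriv j f x| <= M) -> rho K k f <= M.
Proof.
move=> M0 bM; rewrite /rho; set A := [set _ | _ in _].
have [->|/set0P A0] := eqVneq A set0; first by rewrite sup0.
apply: ge_sup => // _ [x Kx <-].
by apply/bigmax_leP; split=> // j _; apply: bM => //; rewrite -ltnS.
Qed.

Lemma Deriv_le_rho f K k x j : compact K -> K `<=` X -> in_Np p k -> K x ->
  (j <= k)%N -> `|Deriv j f x| <= rho K k f.
Proof.
move=> cK KX pk Kx jk; have [M M0 bM] := Cp_bounded f cK KX pk.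
rewrite (@le_trans _ _ (\big[Num.max/0]_(i < k.+1) `|Deriv i f x|))//.
  by apply: (@le_bigmax _ _ _ _ _ (Ordinal (jk : (j < k.+1)%N))).
apply: ub_le_sup; last by exists x.
exists M => _ [z Kz <-].
by apply/bigmax_leP; split=> // i _; apply: bM => //; rewrite -ltnS.
Qed.

(** The topology is generated by balls with arbitrary centres.  As the seminorms
    are directed, these sets form a filter, so that finitely many such balls
    containing 0 contain a single seminorm ball centred at 0. *)
Definition seminorm_nbhs (U : set (Cp oX p E)) :=
  exists K k (d : R), [/\ compact K, K `<=` X, in_Np p k, 0 < d &
    forall f, (forall x j, K x -> (j <= k)%N -> `|Deriv j f x| <= d) -> U f].

Lemma seminorm_nbhs_filter : Filter seminorm_nbhs.
Proof.
split.
- by exists set0, 0%N, 1; split=> //; [exact: compact0|case: (p)].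
- move=> U V [K [k [d [cK KX pk d0 Ud]]]] [L [l [e [cL LX pl e0 Ve]]]].
  exists (K `|` L), (maxn k l), (Num.min d e); split.
  + exact: compactU.
  + by move=> x [/KX|/LX].
  + by rewrite /maxn; case: ifP.
  + by rewrite lt_min d0.
  + move=> f bf; split; [apply: Ud|apply: Ve] => x j Kx jk.
      rewrite (le_trans (bf x j _ _)) ?ge_min ?lexx//; first by left.
      by rewrite leq_max jk.
    rewrite (le_trans (bf x j _ _)) ?ge_min ?lexx ?orbT//; first by right.
    by rewrite leq_max jk orbT.
- move=> U V UV [K [k [d [cK KX pk d0 Ud]]]]; exists K, k, d; split=> // f bf.
  exact/UV/Ud.
Qed.

Lemma rho_ball_seminorm_nbhs g K k e : compact K -> K `<=` X -> in_Np p k ->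
  rho K k (0 - g) < e -> seminorm_nbhs (rho_ball (g, (K, k, e))).
Proof.
move=> cK KX pk ge.
exists K, k, ((e - rho K k (0 - g)) / 2); split; [exact: cK|exact: KX|exact: pk| |].
  by rewrite divr_gt0// subr_gt0.
move=> f bf /=; have r0 : 0 <= (e - rho K k (0 - g)) / 2.
  by rewrite divr_ge0// subr_ge0 ltW.
have g0 : 0 <= rho K k (0 - g).
  rewrite /rho; set A := [set _ | _ in _].
  have [->|/set0P[_ [x Kx _]]] := eqVneq A set0; first by rewrite sup0.
  exact: le_trans (normr_ge0 _) (Deriv_le_rho (0 - g) cK KX pk Kx (leq0n k)).
apply: (@le_lt_trans _ _ ((e - rho K k (0 - g)) / 2 + rho K k (0 - g))).
  apply: rho_le; first exact: addr_ge0.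
  move=> x j Kx jk; have -> : f - g = 1 *: f + (0 - g) by rewrite scale1r sub0r.
  rewrite Deriv_CpD ?scale1r; [|exact: in_Np_le pk|exact: KX].
  rewrite (le_trans (ler_normD _ _))// lerD//; first exact: bf.
  exact: Deriv_le_rho.
by move: (rho _ _ _) ge => r; lra.
Qed.

Lemma open_seminorm_nbhs (U : set (Cp oX p E)) : open U -> U 0 -> seminorm_nbhs U.
Proof.
move=> [DU sDU <-] [V DV V0].
have [D sD DE] := sDU _ DV; rewrite /= in V0.
suff : seminorm_nbhs V.
  by apply: (@filterS _ _ seminorm_nbhs_filter) => f Vf; exists V.
rewrite -DE; apply: (@filter_bigI _ _ _ _ _ seminorm_nbhs_filter) => -[g [[K k] e]] Di.
have [cK KX pk e0] := set_mem (sD _ Di).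
have VD := V0; rewrite -DE in VD; exact: (rho_ball_seminorm_nbhs cK KX pk (VD _ Di)).
Qed.

Lemma open_rho_ball K k e g : compact K -> K `<=` X -> in_Np p k -> 0 < e ->
  open (rho_ball (g, (K, k, e)) : set (Cp oX p E)).
Proof.
move=> cK KX pk e0.
exists [set (rho_ball (g, (K, k, e)) : set (Cp oX p E))]; last by rewrite bigcup_set1.
move=> _ ->; exact: (@finI_from1 _ _ (@rho_index R G X oX p E)
  (@rho_ball R G X oX p E) (g, (K, k, e)) (And4 cK KX pk e0)).
Qed.

End CpElements.

Section Continuity.
Variables (R : realType) (G H E F : normedModType R).
Variables (X : set G) (oX : open X) (Y : set H) (oY : open Y).
Variables (p q : option nat) (T : {linear Cp oX p E -> Cp oY q F}).
Hypothesis cT : continuous T.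

(** A neighbourhood of 0 is mapped into the unit ball of the sup norm over [L];
    homogeneity turns this into a linear estimate.  The bound [b] may be 0, in
    which case larger ones are applied. *)
Lemma continuous_seminorm_bound (L : set H) : compact L -> L `<=` Y ->
  exists K k (C : R), [/\ compact K, K `<=` X, in_Np p k, 0 <= C &
    forall (f : Cp oX p E) b, (forall x j, K x -> (j <= k)%N -> `|Deriv j f x| <= b) ->
      0 <= b -> forall y, L y -> `|T f y| <= C * b].
Proof.
move=> cL LY; have q0 : in_Np q 0 by case: (q).
pose B : set (Cp oY q F) := rho_ball (0, (L, 0%N, 1)).
have oB : open B by exact: open_rho_ball.
have oTB : open (T @^-1` B) by apply: open_comp => // f _; exact: cT.
have TB0 : (T @^-1` B) 0.
  rewrite /B /= linear0 subr0; apply: (@le_lt_trans _ _ 0) => //.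
  by apply: rho_le => // x j _ _; rewrite Deriv_cst0 normr0.
have [K [k [d [cK KX pk d0 Kd]]]] := open_seminorm_nbhs oTB TB0.
have H1 (f : Cp oX p E) : (forall x j, K x -> (j <= k)%N -> `|Deriv j f x| <= d) ->
    forall y, L y -> `|T f y| <= 1.
  move=> bf y Ly; have := Kd f bf; rewrite /B /= subr0 => /ltW H1.
  have H2 := Deriv_le_rho (T f) cL LY q0 Ly (leqnn 0).
  have := le_trans (sym_norm_le (Deriv 0 (T f) y) (fun=> 0)) (_ : _ <= 1).
  by rewrite big_ord0 mulr1; apply; exact: le_trans H2 H1.
exists K, k, d^-1; split=> //; first by rewrite invr_ge0 ltW.
move=> f b bf b0 y Ly.
have H2 c : 0 < c -> b <= c -> `|T f y| <= d^-1 * c.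
  move=> c0 bc; have dc0 : 0 < d / c by rewrite divr_gt0.
  have : `|T ((d / c) *: f) y| <= 1.
    apply: H1 => // x j Kx jk; rewrite Deriv_CpZ; [|exact: in_Np_le pk|exact: KX].
    rewrite normrZ gtr0_norm// mulrAC ler_pdivrMr// ler_wpM2l ?(ltW d0)//.
    exact: le_trans (bf x j Kx jk) bc.
  rewrite linearZ/= normrZ gtr0_norm// => H2.
  rewrite -(ler_pM2l dc0) (le_trans H2)// [leRHS](_ : _ = 1)//.
  by field; rewrite !gt_eqF.
apply/ler_addgt0Pr => e e0; have := H2 (b + d * e).
rewrite mulrDr mulrA mulVf ?gt_eqF// mul1r; apply.
  by rewrite ltr_wpDl// mulr_gt0.
by rewrite lerDl mulr_ge0 ?ltW.
Qed.

End Continuity.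

(** * Bump functions and Taylor polynomials as elements of C^p *)

Section CpConstructions.
Variables (R : realType) (G E : normedModType R) (X : set G) (oX : open X).
Variable p : option nat.

Definition Cp_mul (g : Cp (@openT G) p R) (f : Cp oX p E) : Cp oX p E :=
  mkCp oX (has_jet_Cp oX (has_jet_mul (@subsetT _ X) (Cp_jet g) (Cp_jet f))).

Lemma jet_mul g f x w : in_Np p (size w) -> X x ->
  jet (Cp_mul g f) x w = leib (jet g x) (jet f x) w.
Proof.
move=> pw Xx.
exact: (has_jet_eq oX (has_jet_mul (@subsetT _ X) (Cp_jet g) (Cp_jet f)) pw Xx).
Qed.

Definition Cp_restrict (g : Cp (@openT G) p E) : Cp oX p E :=
  mkCp oX (has_jet_Cp oX (has_jet_patch (@subsetT _ X) (Cp_jet g))).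

Lemma Cp_restrictE g x : X x -> Cp_restrict g x = g x.
Proof. by move=> Xx; rewrite /= /patch mem_set. Qed.

Definition Cp_dilate (g : Cp (@openT G) p E) (c : G) (s : R) (s0 : 0 < s) :
    Cp (@openT G) p E :=
  mkCp (@openT G) (has_jet_Cp (@openT G) (has_jet_dilate c s0 (Cp_jet g))).

Lemma jet_dilate g c s (s0 : 0 < s) x w : in_Np p (size w) ->
  jet (Cp_dilate g c s0) x w = s ^+ size w *: jet g (s *: (x - c)) w.
Proof.
move=> pw.
exact: (has_jet_eq (@openT G) (has_jet_dilate c s0 (Cp_jet g)) pw I).
Qed.

Definition Cp_poly k (S : SymL G E k) (c : G) : Cp oX p E :=
  mkCp oX (has_jet_Cp oX (has_jet_patch (@subsetT _ X) (has_jet_poly S c p))).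

Lemma jet_poly k (S : SymL G E k) c x w : in_Np p (size w) -> X x ->
  jet (Cp_poly S c) x w = pjet S c x w.
Proof.
move=> pw Xx.
exact: (has_jet_eq oX (has_jet_patch (@subsetT _ X) (has_jet_poly S c p)) pw Xx).
Qed.

Lemma Deriv_norm_le (f : Cp oX p E) j x M : 0 <= M -> X x ->
  (forall w, size w = j -> `|jet f x w| <= M * nprod w) -> `|Deriv j f x| <= M.
Proof.
move=> M0 Xx bM; apply: sym_norm_leP => // v.
by rewrite -jet_map -nprod_enum bM// size_map size_enum_ord.
Qed.

Lemma Cp_eq (f g : Cp oX p E) : (forall x, X x -> f x = g x) -> f = g.
Proof.
move=> fg; apply/val_inj/funext => x /=.
have [Xx|Xx] := pselect (X x); first exact: fg.
by rewrite !Cp_out.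
Qed.

Lemma Cp_poly_lin k a (S S' : SymL G E k) c :
  Cp_poly (a *: S + S') c = a *: Cp_poly S c + Cp_poly S' c.
Proof.
apply: Cp_eq => x Xx /=; rewrite !fctE /= /patch !mem_set//; exact: pjet_lin.
Qed.

Lemma Deriv_poly_center k (S : SymL G E k) c : X c -> in_Np p k ->
  Deriv k (Cp_poly S c) c = S.
Proof.
move=> Xc pk; apply/val_inj/funext => v /=.
rewrite -jet_map jet_poly//; last by rewrite size_map size_enum_ord.
by rewrite pjet_center sym_seqE.
Qed.

Lemma Deriv_poly_center0 k (S : SymL G E k) c j : X c -> in_Np p j -> j != k ->
  Deriv j (Cp_poly S c) c = 0.
Proof.
move=> Xc pk jk; apply/val_inj/funext => v /=.
rewrite -jet_map jet_poly//; last by rewrite size_map size_enum_ord.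
by rewrite pjet_center /sym_seq size_map size_enum_ord (negbTE jk).
Qed.

Lemma Deriv_poly_le k (S : SymL G E k) c x j r : X x -> in_Np p j -> 1 <= r ->
  `|x - c| <= r -> `|Deriv j (Cp_poly S c) x| <= `|S| * r ^+ k.
Proof.
move=> Xx pj r1 xr; apply: Deriv_norm_le => //.
  by rewrite mulr_ge0// exprn_ge0// (le_trans _ r1).
by move=> w wj; rewrite jet_poly ?wj//; exact: pjet_le.
Qed.

Lemma Deriv_poly_lip k (S : SymL G E k) c c' x j r : X x -> in_Np p j -> 1 <= r ->
  `|x - c| <= r -> `|x - c'| <= r ->
  `|Deriv j (Cp_poly S c' - Cp_poly S c) x| <= k%:R * (`|S| * `|c' - c|) * r ^+ k.
Proof.
move=> Xx pj r1 xr xr'; rewrite Deriv_CpB//; apply: sym_norm_leP.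
  by rewrite !mulr_ge0// exprn_ge0// (le_trans _ r1).
move=> v; have sv : size [seq v i | i <- enum 'I_j] = j by rewrite size_map size_enum_ord.
rewrite [X in `|X|](_ : _ = Deriv j (Cp_poly S c') x v - Deriv j (Cp_poly S c) x v)//.
rewrite -!jet_map -nprod_enum !jet_poly ?sv//.
rewrite (le_trans (pjet_lip S _ r1 xr xr'))//.
by rewrite opprB (addrC (x - c')) addrA subrK (distrC c).
Qed.

End CpConstructions.

Section Bumps.
Variables (R : realType) (G : normedModType R) (p : option nat).

Definition bump_at (b : G -> R) (c : G) (r : R) :=
  (forall x, `|x - c| <= r / 2 -> b x = 1) /\ (forall x, r <= `|x - c| -> b x = 0).

(** One constant bounds the derivatives of all the dilated bumps, up to the
    factor [r ^ - j] that the dilation costs at order [j]. *)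
Lemma bumps (phi : Cp (@openT G) p R) :
  (forall x, `|x| <= 2^-1 -> phi x = 1) -> (forall x, 1 <= `|x| -> phi x = 0) ->
  (forall k, in_Np p k -> exists M : R, forall x, `|Deriv k phi x| <= M) ->
  forall k, in_Np p k -> exists2 M : R, 0 <= M & forall c r, 0 < r ->
    exists2 b : Cp (@openT G) p R, bump_at b c r &
      forall x w, (size w <= k)%N -> `|jet b x w| <= M * r^-1 ^+ size w * nprod w.
Proof.
move=> phi1 phi0 phiM k pk.
have [M M0 bM] : exists2 M : R, 0 <= M &
    forall j x, (j <= k)%N -> `|Deriv j phi x| <= M.
  elim: k pk => [|k IH] pk.
    have [M bM] := phiM _ pk; exists M; first exact: le_trans (bM 0).
    by move=> j x; rewrite leqn0 => /eqP ->.
  have [N N0 bN] := IH (in_NpS pk); have [M bM] := phiM _ pk.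
  exists (Num.max M N); first by rewrite le_max N0 orbT.
  move=> j x; rewrite leq_eqVlt le_max => /orP[/eqP ->|]; first by rewrite bM.
  by rewrite ltnS => jk; rewrite bN// orbT.
exists M => // c r r0; have s0 : 0 < r^-1 by rewrite invr_gt0.
have nrm x : `|r^-1 *: (x - c)| = `|x - c| / r.
  by rewrite normrZ gtr0_norm// mulrC.
exists (Cp_dilate phi c s0).
  split=> x xr /=.
    by apply: phi1; rewrite nrm ler_pdivrMr// mulrC.
  by apply: phi0; rewrite nrm ler_pdivlMr// mul1r.
move=> x w wk; rewrite jet_dilate; last exact: in_Np_le pk.
rewrite normrZ ger0_norm ?exprn_ge0 ?(ltW s0)// (mulrC M) -mulrA.
rewrite ler_wpM2l ?exprn_ge0 ?(ltW s0)// (le_trans (jet_le_Deriv _ _ _))//.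
by rewrite ler_wpM2r ?nprod_ge0// bM.
Qed.

End Bumps.

(** * The support map *)

Section Support.
Variables (R : realType) (G H E F : normedModType R).
Variables (X : set G) (oX : open X) (Y : set H) (oY : open Y).
Variables (p q : option nat) (T : {linear Cp oX p E -> Cp oY q F}).
Hypothesis bump : forall c r, 0 < r ->
  exists b : Cp (@openT G) p R, bump_at b c r.

(** The support of the functional [f |-> T f y] in terms of [X] alone; the
    compactification is dealt with once and for all in [support_at_Oy]. *)
Definition support_at (y : H) (x : G) := X x /\
  forall V, nbhs x V -> exists f, T f y <> 0 /\ forall z, f z <> 0 -> V z.

(** The value at [y] is controlled by the derivatives on a compact set [K].  If
    no point of [K] were in the support, then around each of them any function
    could be made to vanish, by subtracting its product with a bump, without
    changing its image at [y].  By compactness finitely many such steps make any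
    function vanish near [K], hence all images vanish at [y]. *)
Lemma support_at_exists y : continuous T -> nowhere_trivial T -> Y y ->
  exists x, support_at y x.
Proof.
move=> cT ntT Yy; apply: contrapT => noS.
have yY : [set y] `<=` Y by move=> _ ->.
have [K [k [C [cK KX pk C0 bT]]]] := continuous_seminorm_bound cT (@compact_set1 _ y) yY.
(* [N W]: any function can be made to vanish on [W], keeping its zeros and its
   image at [y]; keeping the zeros makes such sets stable under unions. *)
pose N (W : set G) := forall f, exists g, [/\ T g y = T f y,
  forall z, W z -> g z = 0 & forall z, f z = 0 -> g z = 0].
have NU W W' : N W -> N W' -> N (W `|` W').
  move=> NW NW' f; have [g [Tg gW fg]] := NW f; have [g' [Tg' gW' fg']] := NW' g.
  exists g'; split=> [|z [/gW/fg'//|/gW'//]|z /fg/fg'//].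
  by rewrite Tg'.
pose D : set (G * R) := [set i | 0 < i.2 /\ N (ball i.1 i.2)].
pose B (i : G * R) : set G := ball i.1 i.2.
have oB i : D i -> open (B i) by move=> [i0 _]; exact: ball_open.
have KB : K `<=` cover D B.
  move=> x Kx.
  have [V xV VN] : exists2 V, nbhs x V & forall f : Cp oX p E,
      (forall z, f z <> 0 -> V z) -> T f y = 0.
    apply: contrapT => noV; apply: noS; exists x; split; first exact: KX.
    move=> V xV; apply: contrapT => noF; apply: noV; exists V => // f fV.
    by apply: contrapT => Tf; apply: noF; exists f.
  have /near_dist[r r0 rV] := xV; have [b [b1 b0]] := bump x r0.
  have r2 : 0 < r / 2 by rewrite divr_gt0.
  exists (x, r / 2); last exact: ballxx.
  split=> //= f; exists (f - Cp_mul b f); split.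
  - have Tbf : T (Cp_mul b f) y = 0.
      apply: VN => z bfz; apply: rV; rewrite ltNge; apply/negP => /b0 bz.
      by apply: bfz; rewrite /= bz scale0r.
    by rewrite linearB -[LHS]/(T f y - T (Cp_mul b f) y) Tbf subr0.
  - move=> z; rewrite /B -ball_normE /= distrC => /ltW/b1 bz.
    by rewrite -[LHS]/(f z - b z *: f z) bz scale1r subrr.
  - by move=> z fz; rewrite -[LHS]/(f z - b z *: f z) fz scaler0 subrr.
have [f Tf] := ntT _ Yy; apply: Tf.
have := cK; rewrite compact_cover => /(_ _ _ _ oB KB)[D' D'D KD'].
pose s := finmap.enum_fset D'; pose W : set G := cover [set` s] B.
have {}D'D i : i \in s -> D i by move=> /D'D/set_mem.
have {}KD' : K `<=` W by exact: KD'.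
have : N W.
  clear KD'; rewrite {}/W; elim: s D'D => [_|i s IH Ds].
    by move=> g; exists g; split => // z [].
  have -> : cover [set` i :: s] B = B i `|` cover [set` s] B.
    apply/seteqP; split=> [z [j /=]|z [Bz|[j js Bz]]].
    - by rewrite inE => /orP[/eqP -> Bz|js Bz]; [left|right; exists j].
    - by exists i => //=; rewrite mem_head.
    - by exists j => //=; rewrite inE js orbT.
  apply: NU.
    exact: (Ds i (mem_head _ _)).2.
  by apply: IH => j js; apply: Ds; rewrite inE js orbT.
move=> /(_ f)[g [<- gW _]].
apply/eqP; rewrite -normr_le0 -[leRHS](mulr0 C).
apply: (bT g 0) => // x j Kx _.
rewrite (@Deriv_near0 _ _ _ W) ?normr0//; last exact: KD'.
by apply: bigcup_open => i /D'D/oB.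
Qed.

Hypothesis sepT : separating T.

(** By separation, since some function with nonzero image at [y] lives where [f]
    vanishes. *)
Lemma support_at_near y x (f : Cp oX p E) : Y y -> support_at y x ->
  (\forall z \near x, f z = 0) -> T f y = 0.
Proof.
move=> Yy [_ Sx] fx; have [g [Tg gV]] := Sx _ fx.
have fg : disjoint_on X f g.
  move=> z _; have [->|/eqP gz] := eqVneq (g z) 0; first by right.
  by left; exact: gV.
by have [] := sepT fg Yy.
Qed.

Lemma support_at_closure y x (f : Cp oX p E) V : Y y -> support_at y x -> T f y <> 0 ->
  nbhs x V -> exists2 z, V z & f z <> 0.
Proof.
move=> Yy Sx Tf xV; apply: contrapT => noz; apply: Tf.
apply: support_at_near Yy Sx _; apply: filterS xV => z Vz.
by apply: contrapT => fz; apply: noz; exists z.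
Qed.

Lemma embedX_cvg x : X x ->
  (@embedX R G X oX p) @ x --> @embedX R G X oX p x.
Proof.
move=> Xx; apply/cvg_sup => psi A /= [_ [[U oU <-] Ux UA]].
have /= nU : nbhs (psi x) (Some @^-1` U).
  have : nbhs (Some (psi x) : one_point_compactification R) U.
    exact: open_nbhs_nbhs.
  by [].
have /near_dist[e e0 eU] := nU.
have := Cp_near psi Xx (divr_gt0 e0 (ltr0n _ 2)); apply: filterS => z pz.
apply: UA; apply: eU; rewrite (le_lt_trans pz)// ltr_pdivrMr// mulr_natr.
by rewrite mulr2n ltrDl.
Qed.

Lemma embedX_AX x : X x -> @AX R G X oX p (@embedX R G X oX p x).
Proof. by move=> Xx; apply: subset_closure; exists x. Qed.

Definition AX_point x (Xx : X x) : @AX R G X oX p :=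
  exist (fun w => w \in @AX R G X oX p) _ (mem_set (embedX_AX Xx)).

(** A bump function distinguishes two points. *)
Lemma embedX_inj x x' : X x -> X x' ->
  @embedX R G X oX p x = @embedX R G X oX p x' -> x = x'.
Proof.
move=> Xx Xx' xx'; apply/eqP; rewrite -subr_eq0 -normr_eq0.
rewrite eq_le normr_ge0 andbT leNgt; apply/negP => r0.
have [b [b1 b0]] := bump x' r0.
have : Some (Cp_restrict oX b x) = Some (Cp_restrict oX b x').
  exact: (congr1 (fun w : Cp oX p R -> option R => w (Cp_restrict oX b)) xx').
move=> /Some_inj; rewrite !Cp_restrictE// b0 ?lexx// b1; last first.
  by rewrite subrr normr0 divr_ge0// ltW.
by move/eqP; rewrite eq_sym oner_eq0.
Qed.

Lemma eval_continuous (psi : Cp oX p R) :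
  continuous (fun w : @AX R G X oX p => \val w psi : one_point_compactification R).
Proof.
move=> w; apply: (@continuous_comp _ _ _ (set_val : @AX R G X oX p -> _)
  (fun g : {ptws Cp oX p R -> one_point_compactification R} => g psi)).
  exact: initial_continuous.
exact: (@proj_continuous (Cp oX p R) (fun=> one_point_compactification R)).
Qed.

Lemma closed_some_segment (a b : R) :
  closed (Some @` `[a, b]%classic : set (one_point_compactification R)).
Proof.
rewrite -openC openE => -[t|] nt.
  have : nbhs t (~` `[a, b]%classic).
    apply: open_nbhs_nbhs; split; first exact/closed_openC/interval_closed.
    by move=> tab; apply: nt; exists t.
  move=> tn; have nS : nbhs t (Some @^-1` (~` (Some @` `[a, b]%classic))).
    by apply: filterS tn => u nu [v vab [vu]]; apply: nu; rewrite -vu.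
  exact: nS.
exists `[a, b]%classic.
  by split; [exact: segment_compact|exact: interval_closed].
by move=> u [[v nv <-]|->//] [v' v'ab [v'v]]; apply: nv; rewrite -v'v.
Qed.

Lemma closure_closed_subset (V : topologicalType) (A B : set V) :
  closed B -> A `<=` B -> closure A `<=` B.
Proof.
by move=> cB AB; rewrite ((closure_id B).1 cB); exact: closure_subset.
Qed.

(** If [z] in the compactification differs from the image of [x], some [psi]
    satisfies [z psi <> psi x].  A function living where [psi] is close to
    [psi x] and with nonzero image at [y] gives a member of [Oy T y] whose
    closure misses [z].  Conversely every function with nonzero image at [y] has
    [x] in the closure of its carrier. *)
Lemma support_at_Oy y x : Y y -> support_at y x ->
  \bigcap_(U in Oy T y) closure U = [set z : @AX R G X oX p | \val z = embedX x].
Proof.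
move=> Yy Sx; have [Xx Sf] := Sx; apply/seteqP; split=> z; last first.
  move=> /= zx U [oU [f [Tf fU]]]; apply: subset_closure; apply: fU => B.
  move=> [_ [[W oW <-] Wz WB]].
  have Wx : \forall x' \near x, W (@embedX R G X oX p x').
    apply: (embedX_cvg Xx); apply: open_nbhs_nbhs; split=> //.
    by rewrite -zx; exact: Wz.
  have Xn : nbhs x X by exact: open_nbhs_nbhs.
  have [x' [Wx' Xx'] fx'] := support_at_closure Yy Sx Tf (filterI Wx Xn).
  exists (AX_point Xx'); split; last exact: WB.
  by exists x'; split.
move=> zU; apply: contrapT => zx.
have [psi psiz] : exists psi, (\val z : Cp oX p R -> option R) psi <> Some (psi x).
  by apply: contrapT => npsi; apply: zx; apply/funext => psi; apply: contrapT => h; apply: npsi; exists psi.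
pose c := psi x.
have [r r0 zr] : exists2 r : R, 0 < r & ~ (Some @` `[c - r, c + r]%classic) ((\val z : Cp oX p R -> option R) psi).
  case: (\val z _) psiz => [t tc|_]; last by exists 1 => // -[].
  have tc0 : 0 < `|t - c| by rewrite normr_gt0 subr_eq0; apply/eqP => tc'; apply: tc; rewrite tc'.
  exists (`|t - c| / 2); first by rewrite divr_gt0.
  move=> [s /=]; rewrite in_itv /= -ler_distlC distrC => sr [st]; move: sr.
  by rewrite st ler_pdivlMr// mulr_natr mulr2n gerDl leNgt tc0.
pose U : set (@AX R G X oX p) := (fun w => (\val w psi : one_point_compactification R)) @^-1`
  (Some @` [set t | `|t - c| < r]).
have UO : Oy T y U.
  split.
    apply: open_comp => [w _|]; first exact: eval_continuous.
    apply: one_point_compactification_open_some.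
    rewrite (_ : mkset _ = ball c r); first exact: ball_open.
    by rewrite -ball_normE; apply/seteqP; split=> t /=; rewrite distrC.
  have r2 : 0 < r / 2 by rewrite divr_gt0.
  have [f [Tf fV]] := Sf _ (Cp_near psi Xx r2).
  exists f; split => //.
  have cS : closed ((fun w : @AX R G X oX p => (\val w psi : one_point_compactification R)) @^-1`
      (Some @` `[c - r / 2, c + r / 2]%classic)).
    apply: closed_comp => [w _|]; first exact: eval_continuous.
    exact: closed_some_segment.
  apply: (subset_trans (closure_closed_subset cS _)).
    move=> w [x' [_ /fV psix' wE]]; exists (psi x').
      by rewrite /= in_itv /= -ler_distlC distrC.
    exact: (esym (congr1 (fun g : Cp oX p R -> option R => g psi) wE)).
  move=> w [t /=]; rewrite in_itv /= -ler_distlC distrC => tr tw.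
  exists t => //=; rewrite (le_lt_trans tr)// ltr_pdivrMr// mulr_natr.
  by rewrite mulr2n ltrDl.
have cA : closed ((fun w : @AX R G X oX p => (\val w psi : one_point_compactification R)) @^-1`
    (Some @` `[c - r, c + r]%classic)).
  apply: closed_comp => [w _|]; first exact: eval_continuous.
  exact: closed_some_segment.
apply: zr; apply: (closure_closed_subset cA _ (zU _ UO)).
move=> w [t /= tr tw]; exists t => //=.
by rewrite in_itv /= -ler_distlC distrC ltW.
Qed.

Hypotheses (cT : continuous T) (ntT : nowhere_trivial T).

Lemma support_mapP y : Y y -> support_at y (support_map T y).
Proof.
move=> Yy; have [x Sx] := support_at_exists cT ntT Yy; have [Xx _] := Sx.
have IE := support_at_Oy Yy Sx.
have : exists x, X x /\ \bigcap_(U in Oy T y) closure U =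
    [set z : @AX R G X oX p | \val z = embedX x] by exists x.
move=> /getPex; rewrite -/(support_map T y); set x' := support_map T y => -[Xx' x'E].
suff -> : x' = x by [].
rewrite x'E in IE; apply/esym/(embedX_inj Xx Xx').
have : [set z : @AX R G X oX p | \val z = embedX x]
  (AX_point Xx) by [].
by rewrite -IE.
Qed.

(** If [T f y <> 0] for an [f] living near the support point of [y], then
    [T f y' <> 0] for [y'] near [y], so the support point of [y'] is in the
    closure of the carrier of [f]. *)
Lemma support_map_near y e : Y y -> 0 < e ->
  \forall y' \near y, `|support_map T y' - support_map T y| < e.
Proof.
move=> Yy e0; have [Xh Sh] := support_mapP Yy.
have e2 : 0 < e / 2 by rewrite divr_gt0.
have [f [Tf fV]] : exists f, T f y <> 0 /\
    forall z, f z <> 0 -> `|z - support_map T y| < e / 2.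
  by apply: Sh; apply/near_dist; exists (e / 2).
have YN : \forall y' \near y, Y y' by exact: open_nbhs_nbhs.
have Tf0 : 0 < `|T f y| / 2 by rewrite divr_gt0// normr_gt0; exact/eqP.
near=> y'; have Yy' : Y y' by near: y'.
have : `|T f y' - T f y| <= `|T f y| / 2 by near: y'; exact: Cp_near.
move=> Tfy'; have {}Tfy' : T f y' <> 0.
  move=> Tf'; move: Tfy'; rewrite Tf' sub0r normrN ler_pdivlMr// mulr_natr.
  by rewrite mulr2n gerDl leNgt normr_gt0; move/eqP: Tf => ->.
have nb : nbhs (support_map T y') [set z | `|z - support_map T y'| < e / 2].
  by apply/near_dist; exists (e / 2).
have [z /= zy' /fV zy] := support_at_closure Yy' (support_mapP Yy') Tfy' nb.
rewrite -(subrK z (support_map T y')) -addrA (le_lt_trans (ler_normD _ _))//.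
by rewrite distrC [ltRHS](splitr e) ltrD.
Unshelve. all: by end_near. Qed.

End Support.

(** * Uniformity near a point from uniformity on compact sets *)

Section LocallyUniform.
Variables (R : realType) (H : normedModType R).

(** A filter on this set not clustering at [y0] lives on the finitely many terms
    outside some neighbourhood of [y0]. *)
Lemma compact_cvg_seq (u : nat -> H) y0 : u @ \oo --> y0 ->
  compact (y0 |` range u).
Proof.
move=> uy0 P PP PA; have [|ncl] := pselect (cluster P y0).
  by move=> cl; exists y0; split => //; left.
have [A [B [PA' yB AB]]] : exists A B, [/\ P A, nbhs y0 B & A `&` B = set0].
  apply: contrapT => nAB; apply: ncl => A B PA' yB; apply/set0P/eqP => AB.
  by apply: nAB; exists A, B.
have [N _ uN] := uy0 _ yB.
have cI : compact (u @` `I_N) by apply: finite_compact; exact: finite_image.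
have [|y [[n _ <-] cl]] := cI P PP; last first.
  by exists (u n); split; [right; exists n|exact: cl].
apply: filterS (filterI PA PA') => y [[->|[n _ <-]] Ay].
  have : (A `&` B) y0 by split => //; exact: nbhs_singleton.
  by rewrite AB.
exists n => //=; rewrite ltnNge; apply/negP => Nn.
have : (A `&` B) (u n) by split => //; exact: uN.
by rewrite AB.
Qed.

Lemma compact_norm_bound (K : set H) : compact K ->
  exists2 r : R, 1 <= r & forall x, K x -> `|x| <= r.
Proof.
move=> /compact_bounded[M [_ bM]]; exists (1 + `|M|); first by rewrite lerDl.
by apply: bM; rewrite ltr_pwDl// ler_norm.
Qed.

Lemma invS_lt (d : R) : 0 < d -> exists m : nat, m.+1%:R^-1 < d.
Proof.
move=> d0; exists (Num.truncn d^-1); rewrite invf_plt ?posrE// ?truncnS_gt//.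
Qed.

Lemma invS_anti (m n : nat) : (m <= n)%N -> n.+1%:R^-1 <= m.+1%:R^-1 :> R.
Proof. by move=> mn; rewrite lef_pV2 ?posrE// ler_nat ltnS. Qed.

(** Continuity of an operator into C^q only yields estimates that are uniform on
    compact sets.  They are nevertheless locally uniform: otherwise a sequence
    tending to [y0] would violate all the bounds, although together with its
    limit it forms a compact set. *)
Lemma locally_uniform (Y : set H) (Q : H -> nat -> Prop) : open Y ->
  (forall y m n, (m <= n)%N -> Q y m -> Q y n) ->
  (forall L, compact L -> L `<=` Y -> exists m, forall y, L y -> Q y m) ->
  forall y0, Y y0 -> exists r m, [/\ 0 < r, ball y0 r `<=` Y &
    forall y, ball y0 r y -> Q y m].
Proof.
move=> oY Qle QL y0 Yy0.
have /nbhs_ballP[r0 /= r00 rY] : nbhs y0 Y by exact: open_nbhs_nbhs.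
apply: contrapT => nQ.
have un n : exists y, ball y0 (Num.min r0 n.+1%:R^-1) y /\ ~ Q y n.
  apply: contrapT => nun; apply: nQ; exists (Num.min r0 n.+1%:R^-1), n; split.
  - by rewrite lt_min r00 invr_gt0 ltr0n.
  - by apply: (subset_trans _ rY); apply: le_ball; rewrite ge_min lexx.
  - by move=> y yb; apply: contrapT => nQy; apply: nun; exists y.
have /choice[u uP] := un.
have uy0 : u @ \oo --> y0.
  apply/cvg_ballP => e e0; have [m me] := invS_lt e0.
  exists m => // n /= mn; have [+ _] := uP n; apply: le_ball.
  by rewrite ge_min (le_trans (invS_anti mn) (ltW me)) orbT.
have [|m mQ] := QL _ (compact_cvg_seq uy0).
  move=> y [->//|[n _ <-]]; have [+ _] := uP n => ub; apply: rY.
  by apply: le_ball ub; rewrite ge_min lexx.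
by have [_] := uP m; apply; apply: mQ; right; exists m.
Qed.

End LocallyUniform.

(** * Separating operators are differential operators along the support map *)

Section Representation.
Variables (R : realType) (G H E F : normedModType R).
Variables (X : set G) (oX : open X) (Y : set H) (oY : open Y).
Variables (p q : option nat) (phi : Cp (@openT G) p R).
Hypothesis phi1 : forall x, `|x| <= 2^-1 -> phi x = 1.
Hypothesis phi0 : forall x, 1 <= `|x| -> phi x = 0.
Hypothesis phiM : forall k, in_Np p k -> exists M : R, forall x, `|Deriv k phi x| <= M.
Variable T : {linear Cp oX p E -> Cp oY q F}.
Hypotheses (sepT : separating T) (ntT : nowhere_trivial T) (cT : continuous T).

Local Notation h := (support_map T).

Let bump c r : 0 < r -> exists b : Cp (@openT G) p R, bump_at b c r.
Proof.
move=> r0; have p0 : in_Np p 0 by case: (p).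
by have [M _ /(_ c r r0)[b bb _]] := bumps phi1 phi0 phiM p0; exists b.
Qed.

Lemma support_map_in y : Y y -> X (h y).
Proof. by move=> Yy; have [] := support_mapP bump sepT cT ntT Yy. Qed.

(** Multiplying [f] by a bump at [h y] of small radius [r <= 1] does not change
    [T f y].  On its support, the derivatives of [f] of order [i] are at most
    [eta * r ^ (k - i)] by Taylor, and those of the bump are [O(r ^ - i)].  By
    Leibniz the product is [O(eta * r ^ (k - j))] at order [j], hence [O(eta)] in
    the seminorm that controls [T]; and [eta] is arbitrary. *)
Lemma flat_eq0 (L : set H) K k C (f : Cp oX p E) y :
  K `<=` X -> in_Np p k -> 0 <= C ->
  (forall (f : Cp oX p E) b, (forall x j, K x -> (j <= k)%N -> `|Deriv j f x| <= b) ->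
      0 <= b -> forall y, L y -> `|T f y| <= C * b) ->
  L y -> Y y -> (forall j, (j <= k)%N -> Deriv j f (h y) = 0) -> T f y = 0.
Proof.
move=> KX pk C0 bT Ly Yy f0.
have Sh := support_mapP bump sepT cT ntT Yy; have [Xh _] := Sh.
have [M M0 bM] := bumps phi1 phi0 phiM pk.
have jf0 w : (size w <= k)%N -> jet f (h y) w = 0.
  by move=> wk; rewrite jetE f0.
suff est eta : 0 < eta -> `|T f y| <= C * (M * eta * 2 ^+ k).
  apply/eqP; rewrite -normr_le0; apply/ler_addgt0Pr => e e0; rewrite add0r.
  have c0 : 0 < C * M * 2 ^+ k + 1 by rewrite ltr_wpDl// !mulr_ge0// exprn_ge0.
  rewrite (le_trans (est _ (divr_gt0 e0 c0)))//.
  rewrite [leLHS](_ : _ = e * ((C * M * 2 ^+ k) / (C * M * 2 ^+ k + 1))).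
    rewrite ler_piMr ?(ltW e0)// ler_pdivrMr// mul1r lerDl//.
  by field; rewrite gt_eqF.
move=> eta0; have [d d0 fd] := jet_small oX (Cp_jet f) Xh pk jf0 eta0.
pose r := Num.min 1 (d / 2); have r0 : 0 < r by rewrite lt_min ltr01 divr_gt0.
have r1 : r <= 1 by rewrite ge_min lexx.
have rd : r < d.
  by rewrite (@le_lt_trans _ _ (d / 2)) ?ge_min ?lexx ?orbT// ltr_pdivrMr// mulr_natr mulr2n ltrDl.
have [b [b1 b0] bb] := bM (h y) r r0.
have -> : T f y = T (Cp_mul b f) y.
  apply/eqP; rewrite -subr_eq0 -[X in X == 0]/((T f - T (Cp_mul b f)) y) -linearB.
  apply/eqP; apply: (support_at_near sepT Yy Sh).
  apply/near_dist; exists (r / 2); first exact: divr_gt0.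
  by move=> z /ltW/b1 bz; rewrite -[LHS]/(f z - b z *: f z) bz scale1r subrr.
apply: (bT _ _ _ _ y Ly); last by rewrite !mulr_ge0 ?exprn_ge0// ltW.
move=> x j /KX Xx jk; have pj : in_Np p j by exact: in_Np_le pk.
have [xr|rx] := leP `|x - h y| r; last first.
  rewrite (@Deriv_near0 _ _ _ [set x | r < `|x - h y|]) ?normr0//.
  - by rewrite !mulr_ge0 ?exprn_ge0// ltW.
  - rewrite openE => z /= rz; apply/near_dist; exists (`|z - h y| - r).
      by rewrite subr_gt0.
    move=> z' zz' /=; rewrite ltrBrDl -ltrBrDr in zz'; rewrite (lt_le_trans zz')//.
    by rewrite lerBlDr -[leLHS](_ : `|(z' - h y) - (z' - z)| = _)
      ?(le_trans (ler_normB _ _))// opprB addrC addrA subrK.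
  - by move=> z /= /ltW/b0 ->; rewrite scale0r.
apply: Deriv_norm_le => //; first by rewrite !mulr_ge0 ?exprn_ge0// ltW.
move=> w wj; rewrite jet_mul ?wj//.
have [_ fx] := fd x (le_lt_trans xr rd).
have s0 : 0 <= r^-1 by rewrite invr_ge0 ltW.
have wk : (size w <= k)%N by rewrite wj.
have e0 : 0 <= eta * r ^+ k by rewrite mulr_ge0 ?exprn_ge0 ?ltW.
have := leib_le_scaled s0 M0 e0 (bb x) _ wk; move=> /(_ E (jet f x)) bl.
rewrite (le_trans (bl _))//.
  move=> u uk; rewrite (le_trans (fx u uk))// ler_wpM2r ?nprod_ge0//.
  rewrite -mulrA ler_wpM2l ?(ltW eta0)//.
  rewrite -{2}(subnK uk) exprD -mulrA -exprMn mulfV ?gt_eqF// expr1n mulr1.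
  by rewrite lerXn2r ?nnegrE// ltW.
rewrite ler_wpM2r ?nprod_ge0//.
have rk : r ^+ k * r^-1 ^+ size w <= 1.
  rewrite -{1}(subnK wk) exprD -mulrA -exprMn mulfV ?gt_eqF// expr1n mulr1.
  by rewrite exprn_ile1// ltW.
rewrite exprMn [leLHS](_ : _ = M * eta * 2 ^+ size w * (r ^+ k * r^-1 ^+ size w)); last by ring.
rewrite (le_trans (ler_piMr _ rk)) ?mulr_ge0 ?exprn_ge0 ?(ltW eta0)//.
by rewrite ler_wpM2l ?mulr_ge0 ?(ltW eta0)// ler_weXn2l// ler1n.
Qed.

(** The only choice compatible with the representation, which must hold for the
    homogeneous polynomial whose single nonzero derivative at [h y] is [S]. *)
Definition Phi k (y : H) (S : SymL G E k) : F := T (Cp_poly oX p S (h y)) y.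

Lemma Phi_linear k y : linear (Phi y : SymL G E k -> F).
Proof. by move=> a S S'; rewrite /Phi Cp_poly_lin linearP. Qed.

(** Functions flat to order [k] at [h y] are annihilated, so [T f y] only
    depends on the Taylor polynomial of [f] at [h y]. *)
Lemma T_taylor y k (f : Cp oX p E) : Y y -> in_Np p k ->
  (forall g : Cp oX p E, (forall j, (j <= k)%N -> Deriv j g (h y) = 0) -> T g y = 0) ->
  T f y = \sum_(0 <= i < k.+1) Phi y (Deriv i f (h y)).
Proof.
move=> Yy pk T0; have Xh := support_map_in Yy.
pose P i := Cp_poly oX p (Deriv i f (h y)) (h y).
have : T (f - \sum_(0 <= i < k.+1) P i) y = 0.
  apply: T0 => j jk; have pj : in_Np p j by exact: in_Np_le pk.
  rewrite Deriv_CpB// Deriv_Cp_sum// big_mkord.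
  rewrite (bigD1 (Ordinal (jk : (j < k.+1)%N)))//.
  have -> : Deriv j (P (Ordinal (jk : (j < k.+1)%N))) (h y) = Deriv j f (h y).
    exact: Deriv_poly_center.
  rewrite big1 => [|i ij]; first by rewrite [X in _ - X]addr0 subrr.
  apply: Deriv_poly_center0 => //.
  by apply: contra_neq ij => ji; apply: val_inj.
rewrite linearB linear_sum -[LHS]/(T f y - (\sum_(0 <= i < k.+1) T (P i)) y).
by rewrite Cp_sumE => /eqP; rewrite subr_eq0 => /eqP.
Qed.

Lemma Phi_high y k n (S : SymL G E n) : Y y -> in_Np p k -> (k < n)%N ->
  (forall g : Cp oX p E, (forall j, (j <= k)%N -> Deriv j g (h y) = 0) -> T g y = 0) ->
  Phi y S = 0.
Proof.
move=> Yy pk kn T0; apply: T0 => j jk; apply: Deriv_poly_center0.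
- exact: support_map_in.
- exact: in_Np_le pk.
- by rewrite ltn_eqF// (leq_ltn_trans jk).
Qed.

Lemma flat_order (L : set H) : compact L -> L `<=` Y ->
  exists2 k, in_Np p k & forall y (g : Cp oX p E), L y ->
    (forall j, (j <= k)%N -> Deriv j g (h y) = 0) -> T g y = 0.
Proof.
move=> cL LY; have [K [k [C [cK KX pk C0 bT]]]] := continuous_seminorm_bound cT cL LY.
by exists k => // y g Ly; exact: flat_eq0 KX pk C0 bT Ly (LY _ Ly).
Qed.

Lemma Phi_cvg (f : Cp oX p E) y : Y y ->
  (fun n => \sum_(0 <= k < n | in_Np p k) Phi y (Deriv k f (h y))) @ \oo --> T f y.
Proof.
move=> Yy; have yY : [set y] `<=` Y by move=> _ ->.
have [k pk T0] := flat_order (@compact_set1 _ y) yY.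
have {}T0 g := T0 y g erefl.
apply: cvg_near_cst; exists k.+1 => // n /= kn.
rewrite (big_cat_nat (n := k.+1))//= [X in _ + X](_ : _ = 0) ?addr0; last first.
  rewrite big_nat_cond big1// => i /andP[/andP[ki _] _].
  exact: Phi_high T0.
rewrite (T_taylor f Yy pk T0) big_nat_cond [RHS]big_nat_cond.
apply: eq_bigl => i; rewrite andbT; case: (ltnP i k.+1) => //= ik.
by rewrite (in_Np_le _ pk).
Qed.

(** For [y] near [y0] the centres [h y] stay bounded, so on a compact set the
    derivatives of the polynomials are bounded by a multiple of [`|S|].  As
    compact sets may reach far from [y0], nearness to [y0] is made part of [Q]. *)
Lemma Phi_locally_bounded k y0 : Y y0 -> exists r M : R,
  0 < r /\ forall y (S : SymL G E k), ball y0 r y -> `|Phi y S| <= M * `|S|.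
Proof.
move=> Yy0; have Xh := support_map_in Yy0.
pose Q y m := `|y - y0| < m.+1%:R^-1 -> forall S : SymL G E k, `|Phi y S| <= m%:R * `|S|.
have [||r [m [r0 rY rQ]]] := @locally_uniform _ _ Y Q oY _ _ _ Yy0.
- move=> y m n mn Qm yn S; rewrite (le_trans (Qm _ S)) ?(lt_le_trans yn) ?invS_anti//.
  by rewrite ler_wpM2r// ler_nat.
- move=> L cL LY.
  have [K [j [C [cK KX pj C0 bT]]]] := continuous_seminorm_bound cT cL LY.
  have [rK rK1 bK] := compact_norm_bound cK.
  pose r := rK + (`|h y0| + 1).
  have r1 : 1 <= r by rewrite (le_trans rK1)// lerDl addr_ge0.
  have r0 : 0 <= r by exact: le_trans r1.
  have /near_dist[d d0 hd] := support_map_near bump sepT cT ntT Yy0 ltr01.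
  have [m md] := invS_lt d0.
  exists (maxn m (Num.truncn (C * r ^+ k)).+1) => y Ly; rewrite /Q => yy0 S.
  have yd : `|y - y0| < d.
    by rewrite (lt_trans yy0)// (le_lt_trans _ md)// invS_anti// leq_maxl.
  have b0 : 0 <= `|S| * r ^+ k by rewrite mulr_ge0 ?exprn_ge0.
  rewrite (le_trans (bT (Cp_poly oX p S (h y)) _ _ b0 y Ly))//.
    move=> x i Kx ij; apply: Deriv_poly_le => //; first exact: KX.
      exact: in_Np_le pj.
    rewrite (le_trans (ler_normB _ _))// lerD ?bK//.
    rewrite -(subrK (h y0) (h y)) (le_trans (ler_normD _ _))// addrC lerD// ltW//.
    exact: hd.
  by rewrite mulrCA mulrC ler_wpM2r// (le_trans (ltW (truncnS_gt _)))// ler_nat leq_maxr.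
exists (Num.min r m.+1%:R^-1), m%:R; split; first by rewrite lt_min r0 invr_gt0 ltr0n.
move=> y S; rewrite -ball_normE /= lt_min => /andP[yr ym].
by apply: rQ; rewrite -?ball_normE//= distrC.
Qed.

(** Replacing the centre [h y] by [h y0] changes the polynomial little in every
    seminorm, and with the centre fixed the image is a continuous function. *)
Lemma Phi_continuous k (S : SymL G E k) : {within Y, continuous (fun y => Phi y S)}.
Proof.
apply: continuous_in_subspaceT => y0 /set_mem Yy0; have Xh := support_map_in Yy0.
apply/cvgrPdist_lt => e e0.
pose Q y m := `|y - y0| < m.+1%:R^-1 -> `|Phi y0 S - Phi y S| < e.
have [||r [m [r0 rY rQ]]] := @locally_uniform _ _ Y Q oY _ _ _ Yy0.
- by move=> y m n mn Qm yn; apply: Qm; rewrite (lt_le_trans yn) ?invS_anti.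
- move=> L cL LY.
  have [K [j [C [cK KX pj C0 bT]]]] := continuous_seminorm_bound cT cL LY.
  have [rK rK1 bK] := compact_norm_bound cK.
  pose r := rK + (`|h y0| + 1).
  have r1 : 1 <= r by rewrite (le_trans rK1)// lerDl addr_ge0.
  have r0 : 0 <= r by exact: le_trans r1.
  pose a := C * (k%:R * `|S| * r ^+ k).
  have a0 : 0 <= a by rewrite !mulr_ge0 ?exprn_ge0.
  have e4 : 0 < e / 4 by rewrite divr_gt0.
  have d'0 : 0 < Num.min 1 (e / 4 / (a + 1)).
    by rewrite lt_min ltr01 divr_gt0// ltr_wpDl.
  have /near_dist[d d0 hd] := support_map_near bump sepT cT ntT Yy0 d'0.
  have /near_dist[d1 d10 hd1] := Cp_near (T (Cp_poly oX p S (h y0))) Yy0 e4.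
  have dd : 0 < Num.min d d1 by rewrite lt_min d0.
  have [m md] := invS_lt dd; exists m => y Ly yy0.
  have := lt_trans yy0 md; rewrite lt_min => /andP[/hd + /hd1 Ty].
  rewrite lt_min => /andP[hy1 hya].
  have {}hya : a * `|h y - h y0| <= e / 4.
    rewrite ltr_pdivlMr ?ltr_wpDl// in hya; rewrite (le_trans _ (ltW hya))// mulrC.
    by rewrite ler_wpM2l// lerDl.
  have b0 : 0 <= k%:R * (`|S| * `|h y - h y0|) * r ^+ k.
    by rewrite !mulr_ge0 ?exprn_ge0.
  have := bT (Cp_poly oX p S (h y) - Cp_poly oX p S (h y0)) _ _ b0 y Ly.
  rewrite linearB => /(_ _) Tyd.
  have {}Tyd : `|Phi y S - T (Cp_poly oX p S (h y0)) y| <= e / 4.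
    rewrite (le_trans (Tyd _))//.
      move=> x i Kx ij; apply: Deriv_poly_lip => //; first exact: KX.
      - exact: in_Np_le pj.
      - rewrite (le_trans (ler_normB _ _))// lerD ?bK// lerDl//.
      - rewrite (le_trans (ler_normB _ _))// lerD ?bK//.
        rewrite -(subrK (h y0) (h y)) (le_trans (ler_normD _ _))// addrC lerD// ltW//.
    by rewrite (le_trans _ hya)// [leLHS](_ : _ = a * `|h y - h y0|)// /a; ring.
  rewrite distrC -(subrK (T (Cp_poly oX p S (h y0)) y) (Phi y S)) -addrA.
  rewrite (le_lt_trans (ler_normD _ _))// (le_lt_trans (lerD Tyd Ty))//.
  by lra.
have [d d0 dr] : exists2 d : R, 0 < d & d <= Num.min r m.+1%:R^-1.
  by exists (Num.min r m.+1%:R^-1) => //; rewrite lt_min r0 invr_gt0 ltr0n.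
apply/near_dist; exists d => // y yd; have := lt_le_trans yd dr.
rewrite lt_min => /andP[yr ym]; apply: rQ => //.
by rewrite -ball_normE /= distrC.
Qed.

Lemma Phi_local_order y0 : Y y0 -> exists (r : R) (k0 : nat),
  [/\ 0 < r, ball y0 r `<=` Y, in_Np p k0 &
    forall k y (S : SymL G E k), in_Np p k -> (k0 < k)%N -> ball y0 r y -> Phi y S = 0].
Proof.
move=> Yy0.
pose Q y m := forall k (S : SymL G E k), in_Np p k -> (m < k)%N -> Phi y S = 0.
have [||r [m [r0 rY rQ]]] := @locally_uniform _ _ Y Q oY _ _ _ Yy0.
- by move=> y m n mn Qm k S pk nk; apply: Qm => //; exact: leq_ltn_trans nk.
- move=> L cL LY; have [k pk T0] := flat_order cL LY; exists k => y Ly n S pn kn.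
  by apply: (@Phi_high y k n S (LY _ Ly) pk kn) => g; exact: T0.
exists r, (if p is Some n then minn m n else m); split=> //.
  by case: (p) => //= n; exact: geq_minr.
move=> k y S pk mk yr; apply: (rQ y yr) => //.
case: (p) pk mk => //= n kn; rewrite gtn_min => /orP[//|].
by rewrite ltnNge kn.
Qed.

Lemma Phi_locally_bounded_le n y0 : Y y0 -> exists2 r : R, 0 < r &
  forall k, (k <= n)%N -> exists M : R,
    forall y (S : SymL G E k), ball y0 r y -> `|Phi y S| <= M * `|S|.
Proof.
move=> Yy0; elim: n => [|n [r r0 rM]].
  have [r [M [r0 rM]]] := Phi_locally_bounded 0 Yy0; exists r => // k.
  by rewrite leqn0 => /eqP ->; exists M.
have [r' [M [r'0 r'M]]] := Phi_locally_bounded n.+1 Yy0.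
exists (Num.min r r'); first by rewrite lt_min r0.
move=> k; rewrite leq_eqVlt => /orP[/eqP ->|kn].
  by exists M => y S yr; apply: r'M; apply: le_ball yr; rewrite ge_min lexx orbT.
have [N rN] := rM k kn; exists N => y S yr; apply: rN.
by apply: le_ball yr; rewrite ge_min lexx.
Qed.

End Representation.

Theorem theorem10 (R : realType) (G H E F : completeNormedModType R)
  (X : set G) (oX : open X) (Y : set H) (oY : open Y)
  (p q : option nat) (p_ge1 : in_Np p 1)
  (bump : exists phi : Cp (@openT G) p R,
    [/\ forall x, `|x| <= 2^-1 -> phi x = 1,
        forall x, 1 <= `|x| -> phi x = 0 &
        forall k, in_Np p k -> exists M : R, forall x, `|Deriv k phi x| <= M])
  (T : {linear Cp oX p E -> Cp oY q F})
  (sepT : separating T) (ntT : nowhere_trivial T) (cT : continuous T) :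
  exists Phi : forall k : nat, H -> SymL G E k -> F,
  [/\ forall (f : Cp oX p E) (y : H), Y y ->
        (fun n => \sum_(0 <= k < n | in_Np p k)
                    Phi k y (Deriv k f (support_map T y))) @ \oo --> T f y,
      forall (k : nat) (y : H), in_Np p k -> Y y ->
        linear (Phi k y) /\
        exists M : R, forall S : SymL G E k, `|Phi k y S| <= M * `|S|,
      forall (k : nat) (S : SymL G E k), in_Np p k ->
        {within Y, continuous (fun y => Phi k y S)} &
      forall y0 : H, Y y0 -> exists (r : R) (k0 : nat),
        [/\ 0 < r, ball y0 r `<=` Y, in_Np p k0,
            forall (k : nat) (y : H) (S : SymL G E k), in_Np p k -> (k0 < k)%N ->
              ball y0 r y -> Phi k y S = 0 &
            forall k : nat, (k <= k0)%N ->
              exists M : R, forall (y : H) (S : SymL G E k),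
                ball y0 r y -> `|Phi k y S| <= M * `|S|]].
Proof.
have [phi [phi1 phi0 phiM]] := bump.
exists (fun k y S => Phi T y S); split.
- by move=> f y Yy; exact: (Phi_cvg phi1 phi0 phiM sepT ntT cT).
- move=> k y pk Yy; split; first exact: Phi_linear.
  have [r [M [r0 rM]]] := Phi_locally_bounded phi1 phi0 phiM sepT ntT cT k Yy.
  by exists M => S; apply: rM; exact: ballxx.
- by move=> k S _; exact: (Phi_continuous phi1 phi0 phiM sepT ntT cT).
- move=> y0 Yy0.
  have [r [k0 [r0 rY pk0 high]]] := Phi_local_order phi1 phi0 phiM sepT ntT cT Yy0.
  have [r' r'0 low] := Phi_locally_bounded_le phi1 phi0 phiM sepT ntT cT k0 Yy0.
  exists (Num.min r r'), k0; split => //.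
  + by rewrite lt_min r0.
  + by apply: (subset_trans _ rY); apply: le_ball; rewrite ge_min lexx.
  + move=> k y S pk kk yr; apply: high => //.
    by apply: le_ball yr; rewrite ge_min lexx.
  + move=> k kk; have [M lowM] := low k kk; exists M => y S yr; apply: lowM.
    by apply: le_ball yr; rewrite ge_min lexx orbT.
Qed.
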